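(* Let $f,h\in\mathcal G$ be such that $a\mapsto f$, $b\mapsto h$ defines a free faithful action of $BS(1,-1)=\langle a,b\mid bab^{-1}=a^{-1}\rangle$ by IETs. Then $\langle f,h\rangle$ is $PL\circ IET$-conjugated to a free action of $BS(1,-1)$ by elements of some $G_n$: there exist $n\ge1$, an IET $E$ and a PL-homeomorphism $R$ of $[0,1)$ such that, with $g=R\circ E$, the maps $g\circ f\circ g^{-1}$ and $g\circ h\circ g^{-1}$ belong to $G_n$ and define a free action of $BS(1,-1)$.
   Context: An interval exchange transformation (IET) is a bijection of $[0,1)$ defined by a finite partition of $[0,1)$ into half-open subintervals and a reordering of these intervals by translations; $\mathcal G$ is the group of all IETs. A PL-homeomorphism of $[0,1)$ is a homeomorphism of $[0,1)$ onto itself that is piecewise affine with finitely many pieces. A group acts freely on $[0,1)$ if the only element having some fixed point is the trivial element. An action is faithful if the corresponding morphism to $\mathcal G$ is injective. Let $\mathcal S_n$ be the group of permutations of $\{1,\dots,n\}$, $\mathbb S_n=[0,\frac1n]/(0=\frac1n)\cong\mathbb R/\frac1n\mathbb Z$, and $I_i=[\frac{i-1}{n},\frac in)$. $G_n$ is the group of IETs $g$ for which there are $\sigma_g\in\mathcal S_n$ and $\alpha_g=(\alpha_1(g),\dots,\alpha_n(g))\in\mathbb S_n^n$ such that $g$ maps $I_i$ onto $I_{\sigma_g(i)}$ by translating $I_i$ to $I_{\sigma_g(i)}$ and then rotating by $\alpha_i(g)$ (mod $\frac1n$ inside $I_{\sigma_g(i)}$). *)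

(* Defs.v *)
From HB Require Import structures.
From mathcomp Require Import all_boot all_order all_algebra perm.
From mathcomp Require Import all_classical all_reals all_analysis.
Set Implicit Arguments.
Unset Strict Implicit.
Unset Printing Implicit Defensive.
Import Order.TTheory GRing.Theory Num.Theory.
Import numFieldNormedType.Exports.
Local Open Scope classical_set_scope.
Local Open Scope ring_scope.

(* Transformations of [0,1) are represented by functions R -> R of which only
   the restriction to [0,1) is meaningful: every predicate below looks at
   values on [0,1) only, and equality of transformations is equality there. *)
Definition I01 (R : realType) : set R := `[0, 1[.
Arguments I01 R : clear implicits.

Definition eq01 (R : realType) (f g : R -> R) : Prop :=
  forall x, I01 R x -> f x = g x.

(* The inverse of a bijection of [0,1); its values outside [0,1) are
   irrelevant. *)
Definition inv01 (R : realType) (f : R -> R) : R -> R := 'pinv_id (I01 R) f.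

Definition conj01 (R : realType) (g f : R -> R) : R -> R :=
  g \o f \o inv01 g.

(* [P c d] holds for each piece [c,d) of some finite partition
   0 = c_0 < c_1 < ... < c_k = 1 of [0,1); s lists c_1, ..., c_k. *)
Definition piecewise01 (R : realType) (P : R -> R -> Prop) : Prop :=
  exists s : seq R, itv_partition 0 1 s /\
    forall i, (i < size s)%N -> P (0 :: s)`_i (0 :: s)`_i.+1.

(* Since f is a bijection, the translated pieces again partition [0,1), i.e.
   they are a reordering of the original ones. *)
Definition is_iet (R : realType) (f : R -> R) : Prop :=
  set_bij (I01 R) (I01 R) f /\
  piecewise01 (fun c d : R =>
    exists t : R, forall x, c <= x < d -> f x = x + t).

Definition is_pl_homeo (R : realType) (f : R -> R) : Prop :=
  [/\ set_bij (I01 R) (I01 R) f,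
      {within I01 R, continuous f},
      {within I01 R, continuous (inv01 f)} &
      piecewise01 (fun c d : R =>
        exists a b : R, forall x, c <= x < d -> f x = a * x + b)].

(* The representative in [0,p) of the class of t in R/pZ, for p > 0. *)
Definition modr (R : realType) (t p : R) : R := t - (Num.floor (t / p))%:~R * p.

(* The intervals I_1, ..., I_n are indexed from 0 by 'I_n, so the left end of
   the i-th one is i / n; alpha i is any real representative of an element of
   R/(1/n)Z. *)
Definition in_Gn (R : realType) (n : nat) (g : R -> R) : Prop :=
  is_iet g /\
  exists (sigma : 'S_n) (alpha : 'I_n -> R),
    forall (i : 'I_n) (x : R), i%:R / n%:R <= x < i.+1%:R / n%:R ->
      g x = (sigma i)%:R / n%:R + modr (x - i%:R / n%:R + alpha i) n%:R^-1.

(* BS(1,-1) = < a, b | b a b^-1 = a^-1 > is the set of words in the letters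
   a, b, a^-1, b^-1 modulo bs_eq. The boolean is true for an inverse letter. *)
Inductive bs_gen : Type := bs_a | bs_b.

Definition bs_word : Type := seq (bs_gen * bool).

Inductive bs_eq : bs_word -> bs_word -> Prop :=
| bs_refl u : bs_eq u u
| bs_sym u v : bs_eq u v -> bs_eq v u
| bs_trans u v w : bs_eq u v -> bs_eq v w -> bs_eq u w
| bs_cancel u v (x : bs_gen) (e : bool) :
    bs_eq (u ++ [:: (x, e); (x, ~~ e)] ++ v) (u ++ v)
| bs_relator u v :
    bs_eq (u ++ [:: (bs_b, false); (bs_a, false); (bs_b, true)] ++ v)
          (u ++ [:: (bs_a, true)] ++ v).

Definition bs_letter_eval (R : realType) (f h : R -> R)
    (l : bs_gen * bool) : R -> R :=
  let k := match l.1 with bs_a => f | bs_b => h end in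
  if l.2 then inv01 k else k.

(* A word acts as the composite of its letters, the rightmost one first. *)
Definition bs_eval (R : realType) (f h : R -> R) (w : bs_word) : R -> R :=
  foldr (fun l k => bs_letter_eval f h l \o k) id w.

(* For f and h in a group of bijections of [0,1): a |-> f, b |-> h induces a
   well-defined morphism from BS(1,-1) to that group. *)
Definition bs_action (R : realType) (f h : R -> R) : Prop :=
  forall u v, bs_eq u v -> eq01 (bs_eval f h u) (bs_eval f h v).

Definition bs_faithful (R : realType) (f h : R -> R) : Prop :=
  forall u v, eq01 (bs_eval f h u) (bs_eval f h v) -> bs_eq u v.

Definition bs_free (R : realType) (f h : R -> R) : Prop :=
  forall w, (exists2 x, I01 R x & bs_eval f h w x = x) -> bs_eq w [::].

(* Main.v *)
(* An interval exchange is continuous from the right; on (0,1] it also has a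
   version that is continuous from the left. The group thus acts on [0,1) and on
   (0,1], freely in both cases, and the two actions agree off a finite set.
   BS(1,-1) being one-ended, they are conjugate by a bijection t : [0,1) -> (0,1]
   that moves only finitely many points: t x = lim f'^-n f^n x, where f' is the
   left version of f. Gluing the left end t x to the right end x turns [0,1) into
   a finite union of circles on which the group acts continuously, hence by
   rotations followed by translations from one circle to another. Laying the
   circles side by side is the interval exchange E, and normalizing their lengths
   to 1/n is the PL-homeomorphism P. *)

Require Import Defs.
From mathcomp Require Import all_boot all_order all_algebra perm.
From mathcomp Require Import all_classical all_reals all_analysis.
From mathcomp Require Import zify ring lra.
Set Implicit Arguments.
Unset Strict Implicit.
Unset Printing Implicit Defensive.
Import Order.TTheory GRing.Theory Num.Theory.
Import numFieldNormedType.Exports.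
Local Open Scope classical_set_scope.
Local Open Scope ring_scope.

(** * Almost equal free actions of the Klein bottle group *)

(** The stable value of [f'^-n f^n x] intertwines [f] and [f'] by construction. The obstacle is [h]:
    since [f^n h = h f^-n], the image of [h x] is governed by the backward ray of [x], and for a
    mere action of the integers the forward and backward limits can differ, for instance when [f']
    is the shift with one point of the orbit removed. Hence the need for a second direction in which
    to go around the finite set of disagreement. Freeness enters as finiteness: distinct exponents
    give distinct points, so orbits leave every finite set. It also bounds the moved points, because
    a point can move only if both of its rays meet that set. On the circles, a flow line is
    determined by its starting point, and [f] and [h] send flow lines to flow lines. Following one
    origin per circle thus gives the target circle, the angle and, by comparing periods, the
    equality of lengths. Circles in different orbits may have different lengths, hence the affine
    rescaling. *)

(* A free action of BS(1,-1) on [X], with [fi] the inverse of [f] and the relator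
   read as [f h f = h]. Freeness is only required of the elements [a^n b^m] with
   [n, m >= 0]; [kp_free_mixed] recovers the other signs. *)
Record klein_pair (T : Type) (X : set T) (f fi h : T -> T) : Prop := KleinPair {
  kp_f : forall x, X x -> X (f x);
  kp_fi : forall x, X x -> X (fi x);
  kp_h : forall x, X x -> X (h x);
  kp_fK : forall x, X x -> fi (f x) = x;
  kp_fiK : forall x, X x -> f (fi x) = x;
  kp_hI : forall x y, X x -> X y -> h x = h y -> x = y;
  kp_rel : forall x, X x -> f (h (f x)) = h x;
  kp_free : forall n m x, X x -> iter n f (iter m h x) = x ->
    n = 0%N /\ m = 0%N }.

Lemma iter_stable (T : Type) (X : set T) (f : T -> T) n x :
  (forall x, X x -> X (f x)) -> X x -> X (iter n f x).
Proof. by move=> fX Xx; elim: n => //= n; exact: fX. Qed.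

Lemma iter_cancel (T : Type) (X : set T) (f g : T -> T) n x :
  (forall x, X x -> X (f x)) -> (forall x, X x -> g (f x) = x) -> X x ->
  iter n g (iter n f x) = x.
Proof.
move=> fX fK Xx; elim: n => //= n IH.
by rewrite -iterS iterSr fK //; exact: iter_stable.
Qed.

Lemma iter_inj_on (T : Type) (X : set T) (f : T -> T) n x y :
  (forall x, X x -> X (f x)) -> (forall x y, X x -> X y -> f x = f y -> x = y) ->
  X x -> X y -> iter n f x = iter n f y -> x = y.
Proof.
move=> fX fI Xx Xy; elim: n => //= n IH /fI e; apply: IH; apply: e; exact: iter_stable.
Qed.

Section KleinPair.
Variables (T : Type) (X : set T) (f fi h : T -> T).
Hypothesis K : klein_pair X f fi h.

Lemma kp_fI x y : X x -> X y -> f x = f y -> x = y.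
Proof. by move=> Xx Xy e; rewrite -(kp_fK K Xx) e (kp_fK K Xy). Qed.

Lemma kp_relV x : X x -> f (h x) = h (fi x).
Proof. by move=> Xx; rewrite -{1}(kp_fiK K Xx) (kp_rel K) //; exact: kp_fi K _ Xx. Qed.

Lemma kp_relVi x : X x -> fi (h x) = h (f x).
Proof.
move=> Xx; rewrite -(kp_fK K (kp_h K (kp_f K Xx))) (kp_relV (kp_f K Xx)).
by rewrite (kp_fK K).
Qed.

Lemma kp_iter_rel n x : X x -> iter n f (h x) = h (iter n fi x).
Proof.
move=> Xx; elim: n => //= n ->.
by rewrite kp_relV //; exact: iter_stable (kp_fi K) Xx.
Qed.

Lemma kp_iter_reli n x : X x -> iter n fi (h x) = h (iter n f x).
Proof.
move=> Xx; elim: n => //= n ->.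
by rewrite kp_relVi //; exact: iter_stable (kp_f K) Xx.
Qed.

(** Each [h] reverses [f], so even powers commute with it; this is why detours are made along even
    rows. *)
Lemma kp_iter_even n p x : X x ->
  iter n f (iter p.*2 h x) = iter p.*2 h (iter n f x).
Proof.
move=> Xx; elim: p => //= p IH.
have Xy : X (iter p.*2 h x) by exact: iter_stable (kp_h K) Xx.
by rewrite kp_iter_rel ?kp_iter_reli ?IH //; exact: kp_h K _ _.
Qed.

(** Since [f^n h f^n = h], the hypothesis says that [f^n h^m] fixes [h x], and nonnegative exponents
    suffice. *)
Lemma kp_free_mixed n m x : X x -> iter m h x = iter n f x -> n = 0%N /\ m = 0%N.
Proof.
move=> Xx e; apply: (kp_free K (kp_h K Xx)).
rewrite -iterSr /= e.
rewrite kp_iter_rel; last exact: iter_stable (kp_f K) Xx.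
by rewrite (iter_cancel n (kp_f K) (kp_fK K)).
Qed.

Lemma kp_sym : klein_pair X fi f h.
Proof.
split; try by [exact: kp_f K | exact: kp_fi K | exact: kp_h K | exact: kp_fK K |
  exact: kp_fiK K | exact: kp_hI K].
- by move=> x Xx; rewrite (kp_relVi (kp_fi K Xx)) (kp_fiK K).
- move=> n m x Xx e.
  have Xm : X (iter m h x) by exact: iter_stable (kp_h K) Xx.
  apply: (@kp_free_mixed n m x Xx).
  by rewrite -[in RHS]e (iter_cancel n (kp_fi K) (kp_fiK K)).
Qed.

Lemma kp_param_inj x n m n' m' : X x ->
  iter m h (iter n f x) = iter m' h (iter n' f x) -> n = n' /\ m = m'.
Proof.
wlog le : n m n' m' / (m <= m')%N.
  move=> W Xx e; case: (leqP m m') => [le|/ltnW le]; first exact: W e.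
  by case: (W _ _ _ _ le Xx (esym e)) => -> ->.
move=> Xx; rewrite -(subnKC le); set p := (m' - m)%N; rewrite iterD.
have Xf k : X (iter k f x) by exact: iter_stable (kp_f K) Xx.
have Xh k y : X y -> X (iter k h y) by exact: iter_stable (kp_h K).
move=> /(iter_inj_on (kp_h K) (kp_hI K) (Xf _) (Xh p _ (Xf _))) e.
case: (leqP n n') => [len|/ltnW len].
- move: e; rewrite -(subnK len) iterD; set q := (n' - n)%N => e.
  have Xz : X (iter q f (iter n f x)) by exact: iter_stable (kp_f K) (Xf _).
  have [| -> ->] := @kp_free _ _ _ _ _ K q p _ Xz; first by rewrite -e.
  by rewrite addn0.
- move: e; rewrite -(subnK len) iterD; set q := (n - n')%N => /esym e.
  by have [-> ->] := kp_free_mixed (Xf n') e; rewrite addn0.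
Qed.
End KleinPair.

Lemma functional_bound (T : eqType) (I : Type) (size : I -> nat) (P : T -> I -> Prop)
    (D : seq T) :
  (forall d i j, P d i -> P d j -> i = j) ->
  exists B, forall d i, d \in D -> P d i -> (size i <= B)%N.
Proof.
move=> PI; elim: D => [|d D [B HB]]; first by exists 0%N.
have [[i Pi]|nP] := EM (exists i, P d i).
- exists (maxn (size i) B) => d' j; rewrite inE => /predU1P [-> Pj|Dd' Pj].
    by rewrite (PI _ _ _ Pj Pi) leq_maxl.
  by rewrite leq_max (HB _ _ Dd' Pj) orbT.
- exists B => d' j; rewrite inE => /predU1P [->|]; last exact: HB.
  by move=> Pj; case: nP; exists j.
Qed.

(** By [kp_param_inj] each point of [D] has at most one pair of exponents. Every later choice of a
    large exponent comes from this bound. *)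
Lemma kp_bound (T : eqType) (X : set T) (f fi h : T -> T) (D : seq T) x :
  klein_pair X f fi h -> X x ->
  exists B, forall n m, iter m h (iter n f x) \in D -> (n <= B)%N /\ (m <= B)%N.
Proof.
move=> K Xx.
pose P (d : T) (i : nat * nat) := iter i.2 h (iter i.1 f x) = d.
have [|B HB] := @functional_bound T _ (fun i => i.1 + i.2)%N P D.
  move=> d [n m] [n' m']; rewrite /P /= => <- /esym/(kp_param_inj K Xx).
  by move=> [-> ->].
exists B => n m /(HB _ (n, m)) /(_ erefl) /=; lia.
Qed.

Record almost_equal (T : eqType) (D : seq T) (X X' : set T)
    (f fi h f' fi' h' : T -> T) : Prop := AlmostEqual {
  ae_kp : klein_pair X f fi h;
  ae_kp' : klein_pair X' f' fi' h';
  ae_in : forall x, x \notin D -> X x <-> X' x;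
  ae_f : forall x, x \notin D -> X x -> f x = f' x;
  ae_fi : forall x, x \notin D -> X x -> fi x = fi' x;
  ae_h : forall x, x \notin D -> X x -> h x = h' x }.

Lemma ae_sym (T : eqType) (D : seq T) (X X' : set T) f fi h f' fi' h' :
  almost_equal D X X' f fi h f' fi' h' -> almost_equal D X' X f' fi' h' f fi h.
Proof.
move=> A; split; [exact: ae_kp' A|exact: ae_kp A|..].
- by move=> x /(ae_in A) ->.
- by move=> x xD /(ae_in A xD) Xx; rewrite (ae_f A).
- by move=> x xD /(ae_in A xD) Xx; rewrite (ae_fi A).
- by move=> x xD /(ae_in A xD) Xx; rewrite (ae_h A).
Qed.

Lemma ae_inv (T : eqType) (D : seq T) (X X' : set T) f fi h f' fi' h' :
  almost_equal D X X' f fi h f' fi' h' -> almost_equal D X X' fi f h fi' f' h'.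
Proof.
move=> A; split; [exact: kp_sym (ae_kp A)|exact: kp_sym (ae_kp' A)|..].
- exact: ae_in A.
- exact: ae_fi A.
- exact: ae_f A.
- exact: ae_h A.
Qed.

Lemma iter_agree (T : eqType) (D : seq T) (X : set T) (f f' : T -> T) n x :
  (forall x, X x -> X (f x)) -> (forall x, x \notin D -> X x -> f x = f' x) ->
  X x -> (forall k, (k < n)%N -> iter k f x \notin D) -> iter n f x = iter n f' x.
Proof.
move=> fX ff' Xx; elim: n => //= n IH H.
rewrite -IH; last by move=> k kn; apply: H; exact: ltnW.
by apply: ff'; [exact: H|exact: iter_stable].
Qed.

(* [y] is the limit of the eventually constant sequence [f'^-n f^n x]. *)
Definition matched (T : Type) (f f' : T -> T) (x y : T) :=
  exists N, forall n, (N <= n)%N -> iter n f x = iter n f' y.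

(* The group is one-ended: the forward and the backward ray from [x] are joined,
   outside of any finite set, through the row of [h^M x] with [M] large. *)
Lemma matched_inv (T : eqType) (D : seq T) (X X' : set T) f fi h f' fi' h' x y :
  almost_equal D X X' f fi h f' fi' h' -> X x -> X' y ->
  matched f f' x y -> matched fi fi' x y.
Proof.
move=> A Xx X'y [N HN].
have [K K'] := (ae_kp A, ae_kp' A).
have [B1 HB1] := kp_bound D K Xx.
have [B2 HB2] := kp_bound D (kp_sym K) Xx.
(* Beyond [B], in either coordinate, both quadrants of the orbit avoid [D]; [M] is even so that
   [h^M] commutes with [f]. *)
pose B := (maxn N (maxn B1 B2)).+1; pose M := B.*2.
have [BN BB1 BB2] : [/\ (N < B)%N, (B1 < B)%N & (B2 < B)%N] by rewrite /B; split; lia.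
have Xf k : X (iter k f x) by exact: iter_stable (kp_f K) Xx.
have Xfi k : X (iter k fi x) by exact: iter_stable (kp_fi K) Xx.
have Xh k z : X z -> X (iter k h z) by exact: iter_stable (kp_h K).
have X'h k z : X' z -> X' (iter k h' z) by exact: iter_stable (kp_h K').
have ND1 m k : (B <= k)%N || (B <= m)%N -> iter m h (iter k f x) \notin D.
  by move=> H; apply/negP => /HB1; lia.
have ND2 m k : (B <= k)%N || (B <= m)%N -> iter m h (iter k fi x) \notin D.
  by move=> H; apply/negP => /HB2; lia.
have BM : (B <= M)%N by rewrite /M; lia.
have agree_h k : (B <= k)%N -> iter M h (iter k f x) = iter M h' (iter k f x).
  move=> Bk; apply: (iter_agree (kp_h K) (ae_h A) (Xf k)) => m _.
  by apply: ND1; rewrite Bk.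
have agree_hi k : (B <= k)%N -> iter M h (iter k fi x) = iter M h' (iter k fi x).
  move=> Bk; apply: (iter_agree (kp_h K) (ae_h A) (Xfi k)) => m _.
  by apply: ND2; rewrite Bk.
have row k : iter k f (iter M h x) = iter k f' (iter M h x).
  apply: (iter_agree (kp_f K) (ae_f A) (Xh _ _ Xx)) => m _.
  by rewrite (kp_iter_even K) //; apply: ND1; rewrite BM orbT.
have rowi k : iter k fi (iter M h x) = iter k fi' (iter M h x).
  apply: (iter_agree (kp_fi K) (ae_fi A) (Xh _ _ Xx)) => m _.
  by rewrite (kp_iter_even (kp_sym K)) //; apply: ND2; rewrite BM orbT.
have X'M : X' (iter M h x).
  apply/(ae_in A); last exact: Xh.
  by apply: (ND1 M 0%N); rewrite BM orbT.
(* First half of the detour: out along the forward ray to column [B], up to row [M], back along that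
   row. Both actions agree on the way, so [x] and [y] have the same point above them. *)
have top : iter M h' y = iter M h x.
  apply: (iter_inj_on (n := B) (kp_f K') (kp_fI K') (X'h _ _ X'y) X'M).
  rewrite (kp_iter_even K') // -HN ?(ltnW BN) // -row -agree_h //.
  by rewrite (kp_iter_even K).
exists B => n Bn.
have X'fi : X' (iter n fi x).
  by apply/(ae_in A) => //; apply: (ND2 0%N); rewrite Bn.
have X'fy : X' (iter n fi' y) by exact: iter_stable (kp_fi K') X'y.
(* Second half: from the common point follow row [M] backwards to column [-n], then descend by
   cancelling [h'^M]. *)
apply: (iter_inj_on (n := M) (kp_h K') (kp_hI K') X'fi X'fy).
rewrite -agree_hi // -(kp_iter_even (kp_sym K)) // rowi -top.
by rewrite (kp_iter_even (kp_sym K')).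
Qed.

Lemma matched_ex (T : eqType) (D : seq T) (X X' : set T) f fi h f' fi' h' x :
  almost_equal D X X' f fi h f' fi' h' -> X x -> exists2 y, X' y & matched f f' x y.
Proof.
move=> A Xx; have [K K'] := (ae_kp A, ae_kp' A).
have [B HB] := kp_bound D K Xx.
have Xf k : X (iter k f x) by exact: iter_stable (kp_f K) Xx.
have ND k : (B < k)%N -> iter k f x \notin D.
  by move=> H; apply/negP => /(HB _ 0%N); lia.
have X'B : X' (iter B.+1 f x) by apply/(ae_in A) => //; exact: ND.
exists (iter B.+1 fi' (iter B.+1 f x)); first exact: iter_stable (kp_fi K') X'B.
exists B.+1 => n Bn; rewrite -(subnK Bn) [RHS]iterD.
rewrite (iter_cancel _ (kp_fi K') (kp_fiK K')) // iterD.
apply: (iter_agree (kp_f K) (ae_f A) (Xf _)) => k _.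
by rewrite -iterD; apply: ND; lia.
Qed.

Lemma matched_uniq (T : Type) (X X' : set T) f fi h f' fi' h' x y x' y' :
  klein_pair X f fi h -> klein_pair X' f' fi' h' -> X x -> X x' -> X' y -> X' y' ->
  matched f f' x y -> matched f f' x' y' -> x = x' <-> y = y'.
Proof.
move=> K K' Xx Xx' X'y X'y' [N HN] [N' HN'].
have [{}HN {}HN'] := (HN (maxn N N') (leq_maxl _ _), HN' (maxn N N') (leq_maxr _ _)).
split=> e.
- apply: (iter_inj_on (kp_f K') (kp_fI K') X'y X'y' (n := maxn N N')).
  by rewrite -HN -HN' e.
- apply: (iter_inj_on (kp_f K) (kp_fI K) Xx Xx' (n := maxn N N')).
  by rewrite HN HN' e.
Qed.

Lemma matched_f (T : Type) (f f' : T -> T) x y :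
  matched f f' x y -> matched f f' (f x) (f' y).
Proof. by move=> [N HN]; exists N => n Nn; rewrite -!iterSr HN // ltnW. Qed.

(** As [f^n h = h f^-n], comparing forward at [h x] amounts to comparing backward at [x] and
    applying [h] once, far from [D]. This is the use of [matched_inv]. *)
Lemma matched_h (T : eqType) (D : seq T) (X X' : set T) f fi h f' fi' h' x y :
  almost_equal D X X' f fi h f' fi' h' -> X x -> X' y ->
  matched f f' x y -> matched f f' (h x) (h' y).
Proof.
move=> A Xx X'y xy; have [K K'] := (ae_kp A, ae_kp' A).
have [N HN] := matched_inv A Xx X'y xy.
have [B HB] := kp_bound D (kp_sym K) Xx.
exists (maxn N B.+1) => n; rewrite geq_max => /andP[Nn Bn].
rewrite (kp_iter_rel K) // (kp_iter_rel K') // -HN //.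
apply: (ae_h A); last exact: iter_stable (kp_fi K) Xx.
by apply/negP => /(HB _ 0%N); lia.
Qed.

(** If both rays of [x] meet [D], then [x = f^k d] lies between two points [d], [d'] of [D] on one
    [f]-orbit. The pair determines the number of steps from [d] to [d'], which bounds [k]; finitely
    many [x] remain. *)
Lemma matched_self (T : eqType) (D : seq T) (X X' : set T) f fi h f' fi' h' :
  almost_equal D X X' f fi h f' fi' h' ->
  exists S : seq T, forall x, X x -> x \notin S -> X' x /\ matched f f' x x.
Proof.
move=> A; have [K K'] := (ae_kp A, ae_kp' A).
pose P (dd : T * T) N := X dd.1 /\ iter N f dd.1 = dd.2.
have [|B HB] := @functional_bound _ _ id P [seq (d, d') | d <- D, d' <- D].
  move=> [d d'] n n' [/= Xd <-] [_ /= /esym e].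
  by have [->] := @kp_param_inj _ _ _ _ _ K d n 0%N n' 0%N Xd e.
exists (D ++ [seq iter k f d | k <- iota 0 B.+1, d <- D]) => x Xx.
rewrite mem_cat negb_or => /andP[xD xS].
have X'x : X' x by apply/(ae_in A).
split=> //.
have Xf k : X (iter k f x) by exact: iter_stable (kp_f K) Xx.
have Xfi k : X (iter k fi x) by exact: iter_stable (kp_fi K) Xx.
have [fwd|/existsNP [n]] := EM (forall k, iter k f x \notin D).
  exists 0%N => n _.
  by apply: (iter_agree (kp_f K) (ae_f A) Xx) => k _.
move/negP; rewrite negbK => nD.
have bwd k : iter k fi x \notin D.
  apply/negP => kD; case/negP: xS; apply/allpairsP.
  exists (k, iter k fi x); split=> //; last first.
    by rewrite (iter_cancel _ (kp_fi K) (kp_fiK K)).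
  rewrite mem_iota add0n ltnS; apply: leq_trans (leq_addl n k) _.
  apply: (HB (iter k fi x, iter n f x)).
    by apply/allpairsP; exists (iter k fi x, iter n f x).
  by split; rewrite //= iterD (iter_cancel _ (kp_fi K) (kp_fiK K)).
(* Here only the backward ray avoids [D]; the detour, made for the inverse of [f], turns backward
   matching into forward matching. *)
apply: (matched_inv (ae_inv A)) => //.
exists 0%N => m _.
by apply: (iter_agree (kp_fi K) (ae_fi A) Xx) => k _.
Qed.

Lemma matching_ex (T : eqType) (D : seq T) (X X' : set T) f fi h f' fi' h' :
  almost_equal D X X' f fi h f' fi' h' ->
  exists (t : T -> T) (S : seq T),
    [/\ set_bij X X' t, forall x, X x -> x \notin S -> t x = x,
      forall x, X x -> t (f x) = f' (t x) & forall x, X x -> t (h x) = h' (t x)].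
Proof.
move=> A; have [K K'] := (ae_kp A, ae_kp' A).
have /choice [t Ht] : forall x, exists y, X x -> X' y /\ matched f f' x y.
  move=> x; have [Xx|nXx] := EM (X x); last by exists x.
  by have [y X'y xy] := matched_ex A Xx; exists y.
have tX x : X x -> X' (t x) by move=> /Ht [].
have tm x : X x -> matched f f' x (t x) by move=> /Ht [].
have tE x y : X x -> X' y -> matched f f' x y -> t x = y.
  move=> Xx X'y xy.
  by apply/(matched_uniq K K' Xx Xx (tX _ Xx) X'y (tm _ Xx) xy).
have [S HS] := matched_self A.
exists t, S; split.
- split.
  + by move=> x Xx; exact: tX.
  + move=> x y; rewrite !inE => Xx Xy e.
    by apply/(matched_uniq K K' Xx Xy (tX _ Xx) (tX _ Xy) (tm _ Xx) (tm _ Xy)).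
  + move=> y X'y; have [x Xx [N HN]] := matched_ex (ae_sym A) X'y.
    by exists x => //; apply: tE => //; exists N => n /HN.
- by move=> x Xx /(HS x Xx) [X'x xx]; exact: tE.
- move=> x Xx; apply: tE; [exact: kp_f K _ Xx|exact: kp_f K' _ (tX _ Xx)|].
  by apply: matched_f; exact: tm.
- move=> x Xx; apply: tE; [exact: kp_h K _ Xx|exact: kp_h K' _ (tX _ Xx)|].
  exact: (matched_h A Xx (tX _ Xx) (tm _ Xx)).
Qed.

(** * Words, inverses and conjugation *)

Section Inv01.
Variables (R : realType) (f : R -> R).
Hypothesis f_bij : set_bij (I01 R) (I01 R) f.

Lemma set_bij01_stable x : I01 R x -> I01 R (f x).
Proof. by case: f_bij => + _ _; apply. Qed.

Lemma set_bij01_inj x y : I01 R x -> I01 R y -> f x = f y -> x = y.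
Proof. by case: f_bij => _ + _ Ix Iy; apply; rewrite inE. Qed.

Lemma inv01_bij : set_bij (I01 R) (I01 R) (inv01 f).
Proof. exact: bijpinv_bij. Qed.

Lemma inv01_stable x : I01 R x -> I01 R (inv01 f x).
Proof. by case: inv01_bij => + _ _; apply. Qed.

Lemma inv01K x : I01 R x -> inv01 f (f x) = x.
Proof. by case: f_bij => _ fI _ Ix; apply: (@pinvKV _ _ _ _ _ fI); rewrite inE. Qed.

Lemma inv01Kr x : I01 R x -> f (inv01 f x) = x.
Proof. by case: f_bij => _ _ fS Ix; apply: (@surjpK _ _ _ _ _ _ fS); rewrite inE. Qed.

Lemma inv01_eq x y : I01 R x -> f x = y -> inv01 f y = x.
Proof. by move=> Ix <-; rewrite inv01K. Qed.
End Inv01.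

(* [bs_shift] is left multiplication by a letter in the normal form [a^i b^j],
   encoded as the pair (i, j). *)
Definition bs_shift (l : bs_gen * bool) (p : int * int) : int * int :=
  match l with
  | (bs_a, false) => (p.1 + 1, p.2)
  | (bs_a, true) => (p.1 - 1, p.2)
  | (bs_b, false) => (- p.1, p.2 + 1)
  | (bs_b, true) => (- p.1, p.2 - 1)
  end.

Lemma bs_eq_shift u v : bs_eq u v ->
  forall p, foldr bs_shift p u = foldr bs_shift p v.
Proof.
elim=> //.
- by move=> {}u {}v w _ H1 _ H2 p; rewrite H1 H2.
- move=> {}u {}v x e p; rewrite !foldr_cat; congr foldr.
  by case: x e => [] [] /=; case: (foldr _ _ v) => i j /=; congr pair; lia.
- move=> {}u {}v p; rewrite !foldr_cat; congr foldr => /=.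
  by case: (foldr _ _ v) => i j /=; congr pair; lia.
Qed.

Definition bs_normal n m : bs_word := nseq n (bs_a, false) ++ nseq m (bs_b, false).

(** Acting on the pair [(0, 0)], a normal word returns its own exponents, while equivalent words act
    alike. No normalization of arbitrary words is required. *)
Lemma bs_normal_nontrivial n m : bs_eq (bs_normal n m) [::] -> n = 0%N /\ m = 0%N.
Proof.
move=> /bs_eq_shift /(_ (0, 0)) /=; rewrite foldr_cat.
have -> : foldr bs_shift (0, 0) (nseq m (bs_b, false)) = (0, m%:Z).
  by elim: m => //= m -> /=; rewrite oppr0; congr pair; lia.
have -> : foldr bs_shift (0, m%:Z) (nseq n (bs_a, false)) = (n%:Z, m%:Z).
  by elim: n => //= n -> /=; congr pair; lia.
by case=> -> ->.
Qed.

Section Words.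
Variables (R : realType) (f h : R -> R).
Hypotheses (f_bij : set_bij (I01 R) (I01 R) f) (h_bij : set_bij (I01 R) (I01 R) h).

Lemma bs_eval_normal n m x : bs_eval f h (bs_normal n m) x = iter n f (iter m h x).
Proof. by elim: n => [|n IH] /=; [elim: m => //= m -> | rewrite -IH]. Qed.

Lemma bs_letter_stable l x : I01 R x -> I01 R (bs_letter_eval f h l x).
Proof.
case: l => [[] []]; rewrite /bs_letter_eval /=;
  by [exact: inv01_stable | exact: set_bij01_stable].
Qed.

Lemma bs_eval_stable w x : I01 R x -> I01 R (bs_eval f h w x).
Proof. by move=> Ix; elim: w => //= l w; exact: bs_letter_stable. Qed.

Lemma bs_klein_pair : bs_action f h -> bs_free f h ->
  klein_pair (I01 R) f (inv01 f) h.
Proof.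
move=> act fr; split.
- exact: set_bij01_stable.
- exact: inv01_stable.
- exact: set_bij01_stable.
- exact: inv01K.
- exact: inv01Kr.
- exact: set_bij01_inj.
- move=> x Ix; have Ihx := set_bij01_stable h_bij Ix.
  (* The relator is followed by one more [b] on the right, which cancels [b^-1] and leaves
     [h f = f^-1 h]. *)
  have := act _ _ (bs_relator [::] [:: (bs_b, false)]) x Ix.
  rewrite /bs_eval /= /bs_letter_eval /= inv01K // => ->.
  by rewrite inv01Kr.
- move=> n m x Ix e; apply: bs_normal_nontrivial; apply: fr.
  by exists x => //; rewrite bs_eval_normal.
Qed.

Variable g : R -> R.
Hypothesis g_bij : set_bij (I01 R) (I01 R) g.

Lemma conj01_bij k : set_bij (I01 R) (I01 R) k -> set_bij (I01 R) (I01 R) (conj01 g k).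
Proof.
move=> k_bij; rewrite /conj01.
apply: (set_bij_comp _ g_bij); apply: (set_bij_comp _ k_bij).
exact: inv01_bij.
Qed.

Lemma inv01_conj01 k : set_bij (I01 R) (I01 R) k ->
  eq01 (inv01 (conj01 g k)) (conj01 g (inv01 k)).
Proof.
move=> k_bij x Ix; have Igx := inv01_stable g_bij Ix.
have Ikx := inv01_stable k_bij Igx.
have Igkx := set_bij01_stable g_bij Ikx.
apply: (inv01_eq (conj01_bij k_bij)) => //.
by rewrite /conj01 /= inv01K // inv01Kr // inv01Kr.
Qed.

Lemma bs_eval_conj w :
  eq01 (bs_eval (conj01 g f) (conj01 g h) w) (conj01 g (bs_eval f h w)).
Proof.
move=> x Ix; have Igx := inv01_stable g_bij Ix.
elim: w => [|l w IH]; first by rewrite /conj01 /= inv01Kr.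
have Iw := bs_eval_stable w Igx.
rewrite /= -/(bs_eval _ _ w) IH /conj01 /=.
have Igw := set_bij01_stable g_bij Iw.
case: l => [[] []]; rewrite /bs_letter_eval /=.
- by rewrite inv01_conj01 // /conj01 /= inv01K.
- by rewrite inv01K.
- by rewrite inv01_conj01 // /conj01 /= inv01K.
- by rewrite inv01K.
Qed.

Lemma bs_action_conj : bs_action f h -> bs_action (conj01 g f) (conj01 g h).
Proof.
move=> act u v uv x Ix; rewrite !bs_eval_conj // /conj01 /=.
by rewrite (act _ _ uv) //; exact: inv01_stable.
Qed.

Lemma bs_free_conj : bs_free f h -> bs_free (conj01 g f) (conj01 g h).
Proof.
move=> fr w [x Ix]; rewrite bs_eval_conj // /conj01 /= => e.
have Igx := inv01_stable g_bij Ix.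
apply: fr; exists (inv01 g x) => //.
by rewrite -{2}e inv01K //; exact: bs_eval_stable.
Qed.
End Words.

(** * Left limits of interval exchanges *)

Lemma I01P (R : realType) (x : R) : I01 R x <-> 0 <= x < 1.
Proof. by rewrite /I01 /= in_itv. Qed.

Definition L01 (R : realType) : set R := [set y | 0 < y <= 1].
Arguments L01 R : clear implicits.

(* [f] has a continuous extension from the left at [y], with value [z], and is a
   translation just before [y]. *)
Definition lgerm (R : realType) (f : R -> R) (y z : R) :=
  exists2 e : R, 0 < e & forall s, 0 < s < e -> f (y - s) = z - s.

Section Lgerm.
Variable R : realType.
Implicit Types (f g : R -> R) (x y z : R).

Lemma lgerm_near f y z : L01 R y -> lgerm f y z ->
  exists2 e : R, 0 < e & forall s, 0 < s < e -> I01 R (y - s) /\ f (y - s) = z - s.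
Proof.
move=> /andP[y0 y1] [e e0 H]; exists (Num.min e y); first by rewrite lt_min e0.
move=> s; rewrite lt_min => /and3P[s0 se sy]; split; last by apply: H; rewrite s0.
by apply/I01P; lra.
Qed.

Lemma lgerm_id y : lgerm id y y.
Proof. by exists 1. Qed.

Lemma lgerm_comp f g y z w : lgerm f y z -> lgerm g z w -> lgerm (g \o f) y w.
Proof.
move=> [e e0 H] [e' e'0 H']; exists (Num.min e e'); first by rewrite lt_min e0.
move=> s; rewrite lt_min => /and3P[s0 se se'] /=.
by rewrite H ?H' ?s0.
Qed.

Lemma lgerm_uniq f y z z' : lgerm f y z -> lgerm f y z' -> z = z'.
Proof.
move=> [e e0 H] [e' e'0 H']; pose s := Num.min e e' / 2.
have m0 : 0 < Num.min e e' by rewrite lt_min e0.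
have [s0 sm] : 0 < s /\ s < Num.min e e' by rewrite /s; split; lra.
move: sm; rewrite lt_min => /andP[se se'].
have : z - s = z' - s by rewrite -H ?s0 // H' ?s0.
exact: addIr.
Qed.

Lemma eq01_lgerm f g y z : L01 R y -> eq01 f g -> lgerm f y z -> lgerm g y z.
Proof.
move=> Ly fg /(lgerm_near Ly) [e e0 H]; exists e => // s /H [Is <-].
by rewrite fg.
Qed.

Lemma lgerm_point f y z : L01 R y -> lgerm f y z ->
  exists s, I01 R (y - s) /\ f (y - s) = z - s.
Proof. by move=> Ly /(lgerm_near Ly) [e e0 H]; exists (e / 2); apply: H; lra. Qed.

Lemma lgerm_inj f y y' z : (forall x x', I01 R x -> I01 R x' -> f x = f x' -> x = x') ->
  L01 R y -> L01 R y' -> lgerm f y z -> lgerm f y' z -> y = y'.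
Proof.
move=> fI Ly Ly' /(lgerm_near Ly) [e e0 H] /(lgerm_near Ly') [e' e'0 H'].
pose s := Num.min e e' / 2.
have m0 : 0 < Num.min e e' by rewrite lt_min e0.
have [s0 sm] : 0 < s /\ s < Num.min e e' by rewrite /s; split; lra.
move: sm; rewrite lt_min => /andP[se se'].
have [|I1 e1] := H s; first by rewrite s0.
have [|I2 e2] := H' s; first by rewrite s0.
apply: (@addIr _ (- s)); apply: fI => //.
by rewrite e1 e2.
Qed.

Lemma lgerm_iter f f' n y : (forall y, L01 R y -> L01 R (f' y)) ->
  (forall y, L01 R y -> lgerm f y (f' y)) -> L01 R y ->
  lgerm (iter n f) y (iter n f' y).
Proof.
move=> f'L ff' Ly; elim: n => [|n IH]; first exact: lgerm_id.
by apply: (lgerm_comp IH); apply: ff'; exact: iter_stable.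
Qed.

(** An identity between maps on [[0,1)] holds just to the left of [y], and a left germ determines
    its value. Conversely, if a left version fixes [y], the original fixes the points [y - s] with
    [s] small, so freeness is inherited. *)
Lemma klein_pair_left f fi h f' fi' h' : klein_pair (I01 R) f fi h ->
  (forall y, L01 R y -> L01 R (f' y) /\ lgerm f y (f' y)) ->
  (forall y, L01 R y -> L01 R (fi' y) /\ lgerm fi y (fi' y)) ->
  (forall y, L01 R y -> L01 R (h' y) /\ lgerm h y (h' y)) ->
  klein_pair (L01 R) f' fi' h'.
Proof.
move=> K F Fi H.
have [F1 F2] : (forall y, L01 R y -> L01 R (f' y)) /\
  (forall y, L01 R y -> lgerm f y (f' y)) by split=> y /F [].
have [Fi1 Fi2] : (forall y, L01 R y -> L01 R (fi' y)) /\
  (forall y, L01 R y -> lgerm fi y (fi' y)) by split=> y /Fi [].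
have [H1 H2] : (forall y, L01 R y -> L01 R (h' y)) /\
  (forall y, L01 R y -> lgerm h y (h' y)) by split=> y /H [].
split=> //.
- move=> y Ly; have := lgerm_comp (F2 _ Ly) (Fi2 _ (F1 _ Ly)).
  move=> /(eq01_lgerm (g := id) Ly) /lgerm_uniq; apply; last exact: lgerm_id.
  by move=> x Ix; exact: kp_fK K _ Ix.
- move=> y Ly; have := lgerm_comp (Fi2 _ Ly) (F2 _ (Fi1 _ Ly)).
  move=> /(eq01_lgerm (g := id) Ly) /lgerm_uniq; apply; last exact: lgerm_id.
  by move=> x Ix; exact: kp_fiK K _ Ix.
- move=> y y' Ly Ly' e; apply: (lgerm_inj (kp_hI K) Ly Ly' (H2 _ Ly)).
  by rewrite e; exact: H2.
- move=> y Ly; have [L1 L2] := (F1 _ Ly, H1 _ (F1 _ Ly)).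
  have := lgerm_comp (lgerm_comp (F2 _ Ly) (H2 _ L1)) (F2 _ L2).
  move=> /(eq01_lgerm (g := h) Ly) /lgerm_uniq; apply; last exact: H2.
  by move=> x Ix; exact: kp_rel K _ Ix.
- move=> n m y Ly e.
  have Lm : L01 R (iter m h' y) by exact: iter_stable.
  have := lgerm_comp (lgerm_iter m H1 H2 Ly) (lgerm_iter n F1 F2 Lm).
  rewrite e => /(lgerm_point Ly) [s [Is /= es]].
  exact: (kp_free K Is es).
Qed.
End Lgerm.

(* A version of "[f] is piecewise a translation" that does not require [F] to be
   sorted or contained in [0,1). *)
Definition cuts (R : realType) (F : seq R) (f : R -> R) :=
  forall x y, 0 <= x -> x <= y -> y < 1 -> (forall p, p \in F -> ~~ (x < p <= y)) ->
  f y - f x = y - x.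

Lemma locate (R : realType) (S : nat -> R) n x : S 0%N <= x -> x < S n ->
  exists2 k, (k < n)%N & S k <= x < S k.+1.
Proof.
move=> S0; elim: n => [|n IH] Sn; first by move: (le_lt_trans S0 Sn); rewrite ltxx.
have [/IH [k kn kx]|Sx] := ltP x (S n); last by exists n => //; rewrite Sx.
by exists k => //; exact: ltnW.
Qed.

Lemma gap_left (R : realType) (F : seq R) a z : a < z ->
  exists2 w, a <= w < z & forall p, p \in F -> ~~ (w < p < z).
Proof.
move=> az; elim: F => [|q F [w /andP[aw wz] H]]; first by exists a => //; rewrite lexx.
have [/andP[wq qz]|nq] := boolP (w < q < z); [exists q|exists w] => //.
- by rewrite qz andbT (le_trans aw) // ltW.
- move=> p; rewrite inE => /predU1P [->|/H]; first by rewrite ltxx.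
  by apply: contraNN => /andP[qp ->]; rewrite andbT (lt_trans wq).
- by rewrite aw.
- by move=> p; rewrite inE => /predU1P [->|/H].
Qed.

Lemma gap_right (R : realType) (F : seq R) x b : x < b ->
  exists2 w, x < w <= b & forall p, p \in F -> ~~ (x < p < w).
Proof.
move=> xb; elim: F => [|q F [w /andP[aw wz] H]].
  by exists b => //; rewrite xb lexx.
have [/andP[wq qz]|nq] := boolP (x < q < w); [exists q|exists w] => //.
- by rewrite wq /= (le_trans _ wz) // ltW.
- move=> p; rewrite inE => /predU1P [->|/H]; first by rewrite ltxx andbF.
  by apply: contraNN => /andP[-> qp]; rewrite (lt_trans qp).
- by rewrite aw.
- by move=> p; rewrite inE => /predU1P [->|/H].
Qed.

Lemma last_cut (R : realType) (F : seq R) a y : a <= y ->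
  exists2 p, (p \in a :: F) && (a <= p <= y) & forall q, q \in F -> ~~ (p < q <= y).
Proof.
move=> ay; elim: F => [|q F [p /and3P[pF ap py] H]].
  by exists a => //; rewrite inE eqxx lexx.
have [/andP[pq qy]|nq] := boolP (p < q <= y); [exists q|exists p] => //.
- by rewrite !inE eqxx orbT qy andbT (le_trans ap) // ltW.
- move=> r; rewrite inE => /predU1P [->|/H]; first by rewrite ltxx.
  by apply: contraNN => /andP[qr ->]; rewrite andbT (lt_trans pq).
- by move: pF; rewrite !inE ap py => /orP [->|->]; rewrite ?orbT.
- by move=> r; rewrite inE => /predU1P [->|/H].
Qed.

Section Iet.
Variable R : realType.
Implicit Types (f g : R -> R) (x y z : R) (F : seq R).

Lemma piecewise01_elim (P : R -> R -> Prop) : piecewise01 P ->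
  exists (n : nat) (S : nat -> R), [/\ S 0%N = 0, S n = 1,
    forall i, (i < n)%N -> S i < S i.+1 & forall i, (i < n)%N -> P (S i) (S i.+1)].
Proof.
move=> [s [[sp /eqP sl] H]]; exists (size s), (nth 0 (0 :: s)); split=> //.
- by rewrite -sl (last_nth 0).
- by move=> i im; move/(pathP 0): sp => /(_ i im).
Qed.

Lemma piecewise01_intro (P : R -> R -> Prop) n (S : nat -> R) :
  S 0%N = 0 -> S n = 1 -> (forall i, (i < n)%N -> S i < S i.+1) ->
  (forall i, (i < n)%N -> P (S i) (S i.+1)) -> piecewise01 P.
Proof.
move=> S0 Sn Slt H.
have E i : (i <= n)%N -> (0 :: mkseq (S \o succn) n)`_i = S i.
  by case: i => //= i im; rewrite nth_mkseq.
exists (mkseq (S \o succn) n); rewrite /itv_partition size_mkseq; split.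
- split.
  + apply/(pathP 0) => i; rewrite size_mkseq => im.
    by rewrite E ?nth_mkseq ?(ltnW im) //=; exact: Slt.
  + by rewrite (last_nth 0) size_mkseq E ?Sn.
- by move=> i im; rewrite !E ?(ltnW im) //; exact: H.
Qed.

Lemma iet_cuts f : is_iet f -> exists F, cuts F f.
Proof.
move=> [_ /piecewise01_elim [n [S [S0 Sn Slt H]]]].
exists [seq S i | i <- iota 0 n.+1] => x y x0 xy y1 nF.
have [||k kn /andP[Skx xSk]] := @locate _ S n x; [by rewrite S0|by rewrite Sn; lra|].
have ySk : y < S k.+1.
  rewrite ltNge; apply/negP => Sy.
  have /nF : S k.+1 \in [seq S i | i <- iota 0 n.+1].
    by apply: map_f; rewrite mem_iota; lia.
  by rewrite xSk Sy.
have [t Ht] := H k kn.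
by rewrite !Ht ?Skx ?ySk ?(le_trans Skx) ?(le_lt_trans xy) //; lra.
Qed.

(** The pieces of the inverse start at the images of the starts of the pieces of [f]; [0] is added
    because [F] may omit the start of the first piece. *)
Lemma inv_cuts f F : set_bij (I01 R) (I01 R) f -> cuts F f ->
  cuts [seq f p | p <- 0 :: F] (inv01 f).
Proof.
move=> f_bij cF u v u0 uv v1 nF.
have Iv : I01 R v by apply/I01P; lra.
have Iy := inv01_stable f_bij Iv; have fy := inv01Kr f_bij Iv.
set y := inv01 f v in Iy fy *; move: (Iy) => /I01P /andP[y0 y1].
have [p /andP[pF /andP[p0 py]] Hp] := last_cut F y0.
have tr w : p <= w -> w <= y -> f w - f p = w - p.
  move=> pw wy; apply: cF => // [|q /Hp]; first by lra.
  by apply: contraNN => /andP[-> qw]; rewrite (le_trans qw).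
have fp : f p = v - (y - p) by move: (tr y py (lexx y)); rewrite fy; lra.
(* The piece of [f] through [y], from [p] to [y], has image [[f p, v]]; as [f p] is a cut of the
   inverse, it cannot lie in [(u, v]]. *)
have fpu : f p <= u.
  rewrite leNgt; apply/negP => ufp.
  have /nF : f p \in [seq f p | p <- 0 :: F] by exact: map_f.
  by rewrite ufp fp /=; lra.
have -> : inv01 f u = p + (u - f p).
  apply: inv01_eq => //; first by apply/I01P; lra.
  have := tr (p + (u - f p)); lra.
by lra.
Qed.

Lemma cuts_rgerm f F x : cuts F f -> I01 R x ->
  exists2 e : R, 0 < e & forall s, 0 <= s < e -> x + s < 1 /\ f (x + s) = f x + s.
Proof.
move=> cF /I01P /andP[x0 x1]; have [w /andP[xw w1] H] := gap_right F x1.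
exists (w - x) => [|s /andP[s0 sw]]; first by lra.
split; first by lra.
have : f (x + s) - f x = x + s - x; last by lra.
apply: cF => //; [by lra|by lra|move=> p /H].
by apply: contraNN => /andP[-> ps] /=; lra.
Qed.

(** Left of [y] the values increase to [z] with slope one inside [[0,1)], so [z] can be 1 but not 0:
    this is why left versions act on [(0,1]]. *)
Lemma cuts_lgerm f F y : cuts F f -> (forall x, I01 R x -> I01 R (f x)) -> L01 R y ->
  exists z, L01 R z /\ lgerm f y z.
Proof.
move=> cF fI /andP[y0 y1]; have [w /andP[w0 wy] H] := gap_left F y0.
have tr u v : w < u -> u <= v -> v < y -> f v - f u = v - u.
  move=> wu uv vy; apply: cF => //; [by lra|by lra|move=> p /H].
  by apply: contraNN => /andP[up pv]; lra.
(* The value at [y] is extrapolated from the midpoint of a gap without cuts. *)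
pose m := (w + y) / 2; pose z := f m + (y - m).
have Hz s : 0 < s < y - w -> f (y - s) = z - s.
  move=> /andP[s0 sw]; have [le|/ltW le] := leP m (y - s).
  - by have := tr m (y - s); rewrite /z /m in le *; lra.
  - by have := tr (y - s) m; rewrite /z /m in le *; lra.
have fz s : 0 < s < y - w -> 0 <= z - s < 1.
  by move=> Hs; rewrite -Hz //; apply/I01P; apply: fI; apply/I01P; lra.
exists z; split; last by exists (y - w) => //; lra.
apply/andP; split.
- by have := fz ((y - w) / 2); lra.
- rewrite leNgt; apply/negP => z1.
  pose s := Num.min (z - 1) ((y - w) / 2).
  have [s1 s2] : s <= z - 1 /\ s <= (y - w) / 2.
    by rewrite /s !ge_min !lexx orbT.
  have s0 : 0 < s by rewrite /s lt_min; lra.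
  by have := fz s; lra.
Qed.

Lemma cuts_lgerm_self f F x : cuts F f -> 0 < x < 1 -> x \notin F -> lgerm f x (f x).
Proof.
move=> cF /andP[x0 x1] xF; have [w /andP[w0 wx] H] := gap_left F x0.
exists (x - w) => [|s /andP[s0 sx]]; first by lra.
have : f x - f (x - s) = x - (x - s); last by lra.
apply: cF => //; [by lra|by lra|move=> p pF].
apply/negP => /andP[xp]; rewrite le_eqVlt => /orP [/eqP px|px].
  by move: xF; rewrite -px pF.
by have := H p pF; lra.
Qed.

Lemma lgerm_choice f F : cuts F f -> (forall x, I01 R x -> I01 R (f x)) ->
  exists f' : R -> R, forall y, L01 R y -> L01 R (f' y) /\ lgerm f y (f' y).
Proof.
move=> cF fI; have /choice [f' Hf'] : forall y, exists z, L01 R y -> L01 R z /\ lgerm f y z.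
  move=> y; have [Ly|nLy] := EM (L01 R y); last by exists y.
  by have [z Hz] := cuts_lgerm cF fI Ly; exists z.
by exists f'.
Qed.

Lemma gluing_ex f h : is_iet f -> is_iet h -> bs_action f h -> bs_free f h ->
  exists (t : R -> R) (S : seq R),
    [/\ set_bij (I01 R) (L01 R) t, forall x, I01 R x -> x \notin S -> t x = x,
      forall x, I01 R x -> lgerm f (t x) (t (f x)) &
      forall x, I01 R x -> lgerm h (t x) (t (h x))].
Proof.
move=> f_iet h_iet act fr.
have [f_bij h_bij] := (f_iet.1, h_iet.1).
have K := bs_klein_pair f_bij h_bij act fr.
have [F cF] := iet_cuts f_iet; have [H cH] := iet_cuts h_iet.
have cFi := inv_cuts f_bij cF; set Fi := map _ _ in cFi.
have [f' Hf'] := lgerm_choice cF (kp_f K).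
have [fi' Hfi'] := lgerm_choice cFi (kp_fi K).
have [h' Hh'] := lgerm_choice cH (kp_h K).
have K' := klein_pair_left K Hf' Hfi' Hh'.
(* The points 0 and 1 lie in only one of the two intervals. Elsewhere, off its cuts, each map is
   continuous from the left and agrees with its left version. *)
pose D := [:: 0, 1 & F ++ Fi ++ H].
have DP x : x \notin D -> [/\ x != 0, x != 1, x \notin F, x \notin Fi & x \notin H].
  by rewrite /D !inE !mem_cat !negb_or => /and5P[-> -> -> -> ->].
have D01 x : x \notin D -> I01 R x -> 0 < x < 1.
  by move=> /DP [x0 x1 _ _ _] /I01P /andP[]; rewrite le_eqVlt eq_sym (negPf x0) /= => -> ->.
have same k k' A x : cuts A k -> (forall y, L01 R y -> L01 R (k' y) /\ lgerm k y (k' y)) ->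
    x \notin A -> 0 < x < 1 -> k x = k' x.
  move=> cA Hk xA /[dup] x01 /andP[x0 x1].
  apply: (lgerm_uniq (cuts_lgerm_self cA x01 xA)).
  by have [] := Hk x => //; apply/andP; rewrite x0 ltW.
have A : almost_equal D (I01 R) (L01 R) f (inv01 f) h f' fi' h'.
  split=> //.
  - move=> x /DP [x0 x1 _ _ _]; rewrite I01P /L01 /=.
    by rewrite le_eqVlt eq_sym (negPf x0) /= [x <= 1]le_eqVlt (negPf x1).
  - by move=> x /[dup] /D01 H01 /DP [_ _ xF _ _] /H01; exact: same cF Hf' xF.
  - by move=> x /[dup] /D01 H01 /DP [_ _ _ xF _] /H01; exact: same cFi Hfi' xF.
  - by move=> x /[dup] /D01 H01 /DP [_ _ _ _ xF] /H01; exact: same cH Hh' xF.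
have [t [S [tb tS tf th]]] := matching_ex A.
have tL x : I01 R x -> L01 R (t x) by case: tb => + _ _; apply.
exists t, S; split=> // x Ix.
- by rewrite tf //; have [] := Hf' _ (tL _ Ix).
- by rewrite th //; have [] := Hh' _ (tL _ Ix).
Qed.
End Iet.

(** * The flow on the glued circles *)

(* The flow lines of the translation flow on the circles obtained by gluing the
   left end [t x] to the right end [x]; the time [u] ranges over [0,+oo). *)
Definition flow_line (R : realType) (t b : R -> R) :=
  forall u, 0 <= u -> I01 R (b u) /\ exists2 e : R, 0 < e &
    (forall s, 0 <= s < e -> b (u + s) = b u + s) /\
    (0 < u -> forall s, 0 < s < e -> b (u - s) = t (b u) - s).

Section FlowLine.
Variables (R : realType) (t : R -> R).
Hypothesis t_bij : set_bij (I01 R) (L01 R) t.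

(** Let [w] be the infimum of the times of disagreement. Agreement at [w] would persist to its
    right; disagreement at [w] would, [t] being injective, already occur to its left. *)
Lemma flow_line_uniq b c : flow_line t b -> flow_line t c -> b 0 = c 0 ->
  forall u, 0 <= u -> b u = c u.
Proof.
move=> Fb Fc bc0 u u0; apply: contrapT => bcu.
pose D : set R := [set v | 0 <= v /\ b v <> c v].
have Du : D u by [].
have Dlb : has_lbound D by exists 0 => v [].
pose w := inf D.
have w0 : 0 <= w by apply: lb_le_inf; [exists u | move=> v []].
have before v : 0 <= v -> v < w -> b v = c v.
  move=> v0 vw; apply: contrapT => bcv.
  have wv : w <= v by exact: (ge_inf Dlb).
  by lra.
have [Ib [e e0 [br bl]]] := Fb w w0; have [Ic [e' e'0 [cr cl]]] := Fc w w0.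
have [bcw|bcw] := EM (b w = c w).
- have [v [v0 bcv] vw] : exists2 v, D v & v < w + Num.min e e'.
    by apply: inf_adherent; [rewrite lt_min e0 | split=> //; exists u].
  have wv : w <= v by exact: (ge_inf Dlb).
  apply: bcv; move: vw; rewrite -ltrBlDl lt_min => /andP[ve ve'].
  have -> : v = w + (v - w) by rewrite addrC subrK.
  have [Hv Hv'] : (0 <= v - w < e) /\ (0 <= v - w < e') by split; lra.
  by rewrite br // cr // bcw.
- have w_gt0 : 0 < w.
    by rewrite lt_neqAle w0 andbT; apply/eqP => w_eq0; apply: bcw; rewrite -w_eq0.
  pose m := Num.min (Num.min e e') w; pose s := m / 2.
  have m0 : 0 < m by rewrite !lt_min e0 e'0.
  have [s0 sm] : 0 < s /\ s < m by rewrite /s; split; lra.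
  move: sm; rewrite !lt_min => /andP[/andP[se se'] sw].
  apply: bcw; case: t_bij => _ tI _; apply: tI; rewrite ?inE //.
  apply: (@addIr _ (- s)); rewrite -bl ?s0 // -cl ?s0 //.
  by apply: before; lra.
Qed.

Lemma flow_line_shift b a : 0 <= a -> flow_line t b -> flow_line t (fun u => b (u + a)).
Proof.
move=> a0 Fb u u0; have [|Ib [e e0 [br bl]]] := Fb (u + a); first by lra.
split=> //; exists e => //; split=> [s /br <-|u_gt0 s /bl <-].
- by rewrite addrAC.
- by rewrite addrAC.
- by lra.
Qed.

(** The right germs come from [f] being a translation to the right of each point, the left germs
    from its compatibility with the gluing. *)
Lemma flow_line_map f F b : cuts F f -> (forall x, I01 R x -> I01 R (f x)) ->
  (forall x, I01 R x -> lgerm f (t x) (t (f x))) ->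
  flow_line t b -> flow_line t (f \o b).
Proof.
move=> cF fI ft Fb u u0; have [Ib [e e0 [br bl]]] := Fb u u0.
split; first exact: fI.
have [e' e'0 rg] := cuts_rgerm cF Ib.
have [e'' e''0 lg] := ft _ Ib.
exists (Num.min e (Num.min e' e'')) => [|/=]; first by rewrite !lt_min e0 e'0.
split=> [s|u_gt0 s]; rewrite !lt_min => /and4P[s0 se se' se''].
- by rewrite br ?s0 //; have [|_ ->] := rg s; rewrite ?s0.
- by rewrite bl ?s0 // lg ?s0.
Qed.
End FlowLine.

(** * Chaining the cells between cuts into circles *)

Lemma sorted_cuts (R : realType) (F : seq R) : exists (n : nat) (d : nat -> R),
  [/\ d 0%N = 0, d n.+1 = 1, forall i, (i <= n)%N -> d i < d i.+1 &
    forall p, p \in F -> 0 < p < 1 -> exists2 i, (i <= n)%N & p = d i].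
Proof.
pose s := sort <=%R (undup [seq p <- F | 0 < p < 1]).
have ms p : (p \in s) = (0 < p < 1) && (p \in F).
  by rewrite mem_sort mem_undup mem_filter.
have pth : path <%R 0 (rcons s 1).
  rewrite rcons_path; apply/andP; split.
    rewrite path_sortedE; last exact: lt_trans.
    rewrite sort_lt_sorted undup_uniq andbT.
    by apply/allP => p; rewrite ms => /andP[/andP[]].
  have: last 0 s \in 0 :: s by exact: mem_last.
  rewrite inE => /predU1P [->|]; first exact: ltr01.
  by rewrite ms => /andP[/andP[]].
exists (size s), (nth 0 (0 :: rcons s 1)); split=> //.
- by rewrite /= nth_rcons ltnn eqxx.
- by move=> i le; move/(pathP 0): pth; apply; rewrite size_rcons.
- move=> p pF p01; have ps : p \in s by rewrite ms p01.
  exists (index p s).+1; first by rewrite index_mem.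
  by rewrite /= nth_rcons index_mem ps nth_index.
Qed.

(* [gl k] is a parametrization of the k-th circle, of length [L k]. *)
Record circle_system (R : realType) (t : R -> R) (N : nat) (L : nat -> R)
    (gl : nat -> R -> R) : Prop := CircleSystem {
  cs_pos : forall k, (k < N)%N -> 0 < L k;
  cs_sum : \sum_(k < N) L k = 1;
  cs_line : forall k, (k < N)%N -> flow_line t (gl k);
  cs_period : forall k u, (k < N)%N -> 0 <= u -> gl k (u + L k) = gl k u;
  cs_cover : forall x, I01 R x -> exists k u,
    [/\ (k < N)%N, 0 <= u < L k & gl k u = x];
  cs_inj : forall k k' u u', (k < N)%N -> (k' < N)%N -> 0 <= u < L k ->
    0 <= u' < L k' -> gl k u = gl k' u' -> k = k' /\ u = u';
  cs_cut : piecewise01 (fun c d => exists k u, [/\ (k < N)%N, 0 <= u,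
    u + (d - c) <= L k & forall r, 0 <= r < d - c -> gl k (u + r) = c + r]) }.

Section Circles.
Variables (R : realType) (n : nat) (t : R -> R) (d : nat -> R).
Hypotheses (d0 : d 0%N = 0) (dn : d n.+1 = 1).
Hypothesis d_lt : forall i, (i <= n)%N -> d i < d i.+1.
Hypothesis t_id : forall i r, (i <= n)%N -> d i < r < d i.+1 -> t r = r.
(** [nx i] is the cell entered on leaving cell [i]: its left end is glued to the right end [d i.+1].
    The circles are the cycles of [nx]. *)
Variable nx : 'I_n.+1 -> 'I_n.+1.
Hypothesis nxI : injective nx.
Hypothesis t_nx : forall i : 'I_n.+1, t (d (nx i)) = d i.+1.

Let len (i : 'I_n.+1) : R := d i.+1 - d i.
(* [S x u] is the time at which the flow line from [d x] enters its u-th piece. *)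
Let S (x : 'I_n.+1) (u : nat) : R := \sum_(v < u) len (iter v nx x).
Let L (x : 'I_n.+1) : R := S x (order nx x).

Lemma len_gt0 i : 0 < len i.
Proof. by rewrite subr_gt0; apply: d_lt; rewrite -ltnS. Qed.

Lemma d_mono i j : (i <= j <= n.+1)%N -> d i <= d j.
Proof.
move=> /andP[ij jn]; rewrite -(subnKC ij).
have: (i + (j - i) <= n.+1)%N by rewrite subnKC.
elim: (j - i)%N => [|k IH]; rewrite ?addn0 ?addnS // => H.
by apply: le_trans (IH (ltnW H)) (ltW (d_lt _)); rewrite -ltnS.
Qed.

Lemma d_range (i : 'I_n.+1) : 0 <= d i /\ d i.+1 <= 1.
Proof. by rewrite -d0 -dn; split; apply: d_mono; rewrite ?leqnn ?ltn_ord //= ltnW. Qed.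

Lemma S0 x : S x 0%N = 0.
Proof. by rewrite /S big_ord0. Qed.

Lemma SS x u : S x u.+1 = S x u + len (iter u nx x).
Proof. by rewrite /S big_ord_recr. Qed.

Lemma S_ge0 x u : 0 <= S x u.
Proof. by apply: sumr_ge0 => i _; exact: ltW (len_gt0 _). Qed.

Lemma S_le x u v : (u <= v)%N -> S x u <= S x v.
Proof.
move=> uv; rewrite -(subnKC uv); elim: (v - u)%N => [|k IH]; first by rewrite addn0.
by rewrite addnS SS; have := len_gt0 (iter (u + k) nx x); lra.
Qed.

Lemma S_period x u : S x (u + order nx x) = S x u + L x.
Proof.
rewrite /L; elim: u => [|u IH]; first by rewrite add0n S0 add0r.
by rewrite addSn !SS IH iterD iter_order // addrAC.
Qed.

Lemma L_gt0 x : 0 < L x.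
Proof.
apply: lt_le_trans (S_le x (order_gt0 nx x)).
by rewrite SS S0 add0r len_gt0.
Qed.

Lemma S_unbounded x w : exists u, w < S x u.
Proof.
have SqL q : S x (q * order nx x) = L x *+ q.
  elim: q => [|q IH]; first by rewrite mul0n S0 mulr0n.
  by rewrite mulSn addnC S_period IH mulrSr.
exists (Num.Def.archi_bound (w / L x) * order nx x)%N; rewrite SqL -mulr_natr.
rewrite -ltr_pdivrMl ?L_gt0 // mulrC.
have [w0|w0] := leP 0 w; first by apply: archi_boundP; rewrite divr_ge0 // ltW // L_gt0.
apply: lt_le_trans (ler0n _ _).
by rewrite pmulr_llt0 // invr_gt0 L_gt0.
Qed.

Lemma S_locate x w : 0 <= w ->
  exists u r, [/\ 0 <= r < len (iter u nx x) & w = S x u + r].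
Proof.
move=> w0; have [m wm] := S_unbounded x w.
have [||u _ /andP[Su uS]] := @locate _ (S x) m w; rewrite ?S0 //.
by exists u, (w - S x u); split; [move: uS; rewrite SS; lra | lra].
Qed.

Lemma S_locate_uniq x u r u' r' : 0 <= r < len (iter u nx x) ->
  0 <= r' < len (iter u' nx x) -> S x u + r = S x u' + r' -> u = u' /\ r = r'.
Proof.
wlog le : u r u' r' / (u <= u')%N.
  move=> W H H' e; case: (leqP u u') => [le|/ltnW le]; first exact: W e.
  by have [-> ->] := W _ _ _ _ le H' H (esym e).
move=> Hr Hr' e; move: le; rewrite leq_eqVlt => /predU1P [uu|lt].
  by move: e; rewrite -uu => /addrI ->.
by have := S_le x lt; rewrite SS; lra.
Qed.

Lemma S_order x u r : 0 <= r < len (iter u nx x) -> S x u + r < L x ->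
  (u < order nx x)%N.
Proof.
move=> Hr H; rewrite ltnNge; apply/negP => /(S_le x); rewrite -/(L x); lra.
Qed.

Lemma cell_ex x : I01 R x -> exists (i : 'I_n.+1) r, 0 <= r < len i /\ x = d i + r.
Proof.
move=> /I01P /andP[x0 x1].
have [||k kn /andP[dk kd]] := @locate _ d n.+1 x; rewrite ?d0 ?dn //.
by exists (Ordinal kn), (x - d k); rewrite /len /=; split; lra.
Qed.

Lemma cell_uniq (i i' : 'I_n.+1) r r' : 0 <= r < len i -> 0 <= r' < len i' ->
  d i + r = d i' + r' -> i = i' /\ r = r'.
Proof.
wlog le : i i' r r' / (i <= i')%N.
  move=> W H H' e; case: (leqP i i') => [le|/ltnW le]; first exact: W e.
  by have [-> ->] := W _ _ _ _ le H' H (esym e).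
move=> Hr Hr' e; move: le; rewrite leq_eqVlt => /predU1P [ii|lt].
  by move: e; rewrite (val_inj ii) => /addrI ->.
have : d i.+1 <= d i' by apply: d_mono; rewrite lt ltnW.
by move: Hr; rewrite /len; lra.
Qed.

Lemma circle_param_ex : exists G : 'I_n.+1 -> R -> R,
  forall x u r, 0 <= r < len (iter u nx x) -> G x (S x u + r) = d (iter u nx x) + r.
Proof.
have /choice [G HG] : forall xw : 'I_n.+1 * R, exists y, forall u r,
    0 <= r < len (iter u nx xw.1) -> xw.2 = S xw.1 u + r -> y = d (iter u nx xw.1) + r.
  move=> [x w] /=; have [w0|w0] := leP 0 w.
    have [u [r [Hr ->]]] := S_locate x w0.
    exists (d (iter u nx x) + r) => u' r' Hr' e.
    by have [-> ->] := S_locate_uniq Hr Hr' e.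
  by exists 0 => u r Hr e; have := S_ge0 x u; lra.
by exists (fun x w => G (x, w)) => x u r Hr; exact: (HG (x, S x u + r)).
Qed.

Section Param.
Variable G : 'I_n.+1 -> R -> R.
Hypothesis GE : forall x u r, 0 <= r < len (iter u nx x) ->
  G x (S x u + r) = d (iter u nx x) + r.

Lemma circle_flow_line x : flow_line t (G x).
Proof.
move=> w w0; have [u [r [Hr ->]]] := S_locate x w0; rewrite GE //.
set i := iter u nx x in Hr *; have [di0 di1] := d_range i.
split; first by apply/I01P; move: Hr; rewrite /len; lra.
have right e : e <= len i - r -> forall s, 0 <= s < e -> G x (S x u + r + s) = d i + r + s.
  by move=> er s Hs; rewrite -addrA GE ?addrA //; lra.
(* Inside a cell [t] is the identity. At the start of a cell the flow line arrives from the previous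
   one, whose right end is the [t]-image of the present point; time 0 carries no left condition. *)
have [r0|] := ltP 0 r.
- exists (Num.min r (len i - r)); first by rewrite lt_min; lra.
  split; first by apply: right; rewrite ge_min lexx orbT.
  move=> _ s; rewrite lt_min => /and3P[s0 sr sl].
  rewrite -addrA GE; last by lra.
  by rewrite (@t_id i) 1?addrA // ?leq_ord //; move: Hr; rewrite /len; lra.
- move=> r0; have rE : r = 0 by lra.
  rewrite rE !addr0 in right *; case: u @i Hr di0 di1 right => [|v] i Hr di0 di1 right.
    exists (len i) => [|]; first exact: len_gt0.
    split; first by move=> s Hs; have := right (len i); rewrite subr0 => ->.
    by rewrite S0 ltxx.
  set j := iter v nx x.
  exists (Num.min (len i) (len j)); first by rewrite lt_min !len_gt0.
  split=> [s|_ s]; rewrite lt_min => /and3P[s0 si sj].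
    by have := right (len i); rewrite subr0 => -> //; rewrite s0.
  have -> : S x v.+1 - s = S x v + (len j - s) by rewrite SS -/j; lra.
  rewrite GE -/j; last by lra.
  by rewrite t_nx /len; lra.
Qed.

Lemma circle_period x w : 0 <= w -> G x (w + L x) = G x w.
Proof.
move=> w0; have [u [r [Hr ->]]] := S_locate x w0.
rewrite [S x u + r]addrC -addrA -S_period [r + _]addrC [r + _]addrC.
have it : iter (u + order nx x) nx x = iter u nx x by rewrite iterD iter_order.
by rewrite !GE ?it.
Qed.

Lemma froot_iter (x : 'I_n.+1) u : froots nx x -> froot nx (iter u nx x) = x.
Proof.
move=> /eqP rx; rewrite -[RHS]rx; apply/esym/eqP.
by rewrite (root_connect (fconnect_sym nxI)) fconnect_iter.
Qed.

(** A cell determines its circle through [froot] and, for times below one period, its rank on the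
    circle through [findex]. *)
Lemma circle_inj x x' w w' : froots nx x -> froots nx x' -> 0 <= w < L x ->
  0 <= w' < L x' -> G x w = G x' w' -> x = x' /\ w = w'.
Proof.
move=> rx rx' /andP[w0 wL] /andP[w'0 wL'].
have [u [r [Hr ew]]] := S_locate x w0; have [u' [r' [Hr' ew']]] := S_locate x' w'0.
rewrite ew ew' !GE // => /(cell_uniq Hr Hr') [ei er].
have xx : x = x' by rewrite -(froot_iter u rx) ei (froot_iter u' rx').
rewrite ew ew' er -xx in wL wL' Hr' Hr ei *; split=> //; congr (S x _ + _).
have [uo uo'] := (S_order Hr wL, S_order Hr' wL').
by rewrite -(findex_iter uo) ei findex_iter.
Qed.

Lemma circle_cell (i : 'I_n.+1) : let x := froot nx i in let u := findex nx x i in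
  [/\ froots nx x, S x u + len i <= L x &
    forall r, 0 <= r < len i -> G x (S x u + r) = d i + r].
Proof.
move=> x u; have con : fconnect nx x i.
  by rewrite (fconnect_sym nxI); exact: connect_root.
have itu : iter u nx x = i by exact: iter_findex.
split; first exact: (roots_root (fconnect_sym nxI)).
- by have := S_le x (findex_max con); rewrite SS -/u itu.
- by move=> r Hr; rewrite GE itu.
Qed.
End Param.

Lemma circle_length x : L x = \sum_(i | fconnect nx x i) len i.
Proof.
under eq_bigl => i do rewrite fconnect_orbit.
rewrite -big_uniq ?orbit_uniq // (big_nth x) size_orbit big_mkord.
by apply: eq_bigr => v _; rewrite nth_traject.
Qed.

Lemma sum_circle_length : \sum_(x | froots nx x) L x = 1.
Proof.
have <- : \sum_(i < n.+1) len i = 1.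
  by rewrite -(big_mkord xpredT (fun i => d i.+1 - d i)) telescope_sumr // dn d0 subr0.
rewrite [RHS](partition_big (froot nx) (froots nx)) /=; last first.
  by move=> i _; exact: (roots_root (fconnect_sym nxI)).
apply: eq_bigr => x rx; rewrite circle_length; apply: eq_bigl => i.
have /eqP {2}<- := rx.
by rewrite (root_connect (fconnect_sym nxI)) (fconnect_sym nxI).
Qed.

Lemma circle_system_cells : exists N L gl, circle_system t N L gl.
Proof.
have [G GE] := circle_param_ex.
pose rs := enum (froots nx); pose rt k := nth ord0 rs k.
have rsP x : (x \in rs) = froots nx x by rewrite mem_enum.
have rtP k : (k < size rs)%N -> froots nx (rt k) by rewrite -rsP => /mem_nth ->.
exists (size rs), (L \o rt), (G \o rt); split=> /=.
- by move=> k _; exact: L_gt0.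
- have <- : \sum_(x <- rs) L x = 1.
    by rewrite big_enum -[RHS]sum_circle_length; exact: eq_bigl.
  by rewrite (big_nth ord0) big_mkord.
- by move=> k _; exact: circle_flow_line.
- by move=> k u _; exact: circle_period.
- move=> x /cell_ex [i [r [Hr ->]]].
  have [rx le Gi] := circle_cell GE i.
  exists (index (froot nx i) rs), (S (froot nx i) (findex nx (froot nx i) i) + r).
  rewrite index_mem rsP /rt nth_index ?rsP // Gi //; split=> //.
  by have := S_ge0 (froot nx i) (findex nx (froot nx i) i); lra.
- move=> k k' u u' kN k'N Hu Hu' /(circle_inj GE (rtP _ kN) (rtP _ k'N) Hu Hu') [e ->].
  by split=> //; apply/eqP; rewrite -(nth_uniq ord0 kN k'N) ?enum_uniq //; exact/eqP.
- apply: (piecewise01_intro (n := n.+1) (S := d)) => // i ilt.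
  have [rx le Gi] := circle_cell GE (Ordinal ilt).
  exists (index (froot nx (Ordinal ilt)) rs),
    (S (froot nx (Ordinal ilt)) (findex nx (froot nx (Ordinal ilt)) (Ordinal ilt))).
  rewrite index_mem rsP /rt nth_index ?rsP //; split=> //.
  exact: S_ge0.
Qed.
End Circles.

(** The open cells are fixed pointwise by [t], so the only values left for the left ends are the
    right ends. This matches each cell with its predecessor [pr], and [nx] is the inverse
    permutation. *)
Lemma circle_system_ex (R : realType) (t : R -> R) (F : seq R) :
  set_bij (I01 R) (L01 R) t -> (forall x, I01 R x -> x \notin F -> t x = x) ->
  exists N L gl, circle_system t N L gl.
Proof.
move=> [tL tI tS] tF; have [n [d [d0 dn d_lt dF]]] := sorted_cuts F.
have t_inj x y : I01 R x -> I01 R y -> t x = t y -> x = y.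
  by move=> Ix Iy; apply: tI; rewrite inE.
have dI (i : 'I_n.+1) : I01 R (d i).
  apply/I01P; have [di0 di1] := d_range d0 dn d_lt i.
  by have := d_lt i; rewrite leq_ord => /(_ isT); lra.
have t_id i r : (i <= n)%N -> d i < r < d i.+1 -> t r = r.
  move=> ilt Hr; pose i' : 'I_n.+1 := Ordinal (ilt : (i < n.+1)%N).
  have [/= di0 di1] := d_range d0 dn d_lt i'.
  apply: tF; first by apply/I01P; lra.
  apply/negP => /dF; case=> [|j jn er]; first by lra.
  have := Hr; rewrite er; case: (leqP j i) => ji.
    by have := @d_mono _ _ _ d_lt j i; rewrite ji leqW // => /(_ isT); lra.
  by have := @d_mono _ _ _ d_lt i.+1 j; rewrite ji leqW // => /(_ isT); lra.
have /choice [pr Hpr] : forall j : 'I_n.+1, exists i : 'I_n.+1, t (d j) = d i.+1.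
  move=> j; have /andP[y0 y1] := tL _ (dI j); set y := t (d j) in y0 y1 *.
  have [k kn /andP[dk kd]] : exists2 k, (k < n.+1)%N & d k < y <= d k.+1.
    (* Negating and reversing the cuts makes [locate] return a cell open on the left and closed on
       the right. *)
    have [||k kn /andP[k1 k2]] := @locate _ (fun k => - d (n.+1 - k)%N) n.+1 (- y).
    - by rewrite subn0 dn; lra.
    - by rewrite subnn d0; lra.
    - exists (n - k)%N; first by lia.
      have -> : (n - k = n.+1 - k.+1)%N by lia.
      have -> : ((n.+1 - k.+1).+1 = n.+1 - k)%N by lia.
      by lra.
  exists (Ordinal kn); move: kd; rewrite le_eqVlt => /predU1P [//|ydk].
  (* A value interior to a cell would be fixed by [t], hence equal to [d j] by injectivity, but no
     left end is interior to a cell. *)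
  have Iy : I01 R y.
    have [_] := d_range d0 dn d_lt (Ordinal kn); rewrite /= => dk1.
    by apply/I01P; lra.
  have dky : d k < y < d k.+1 by rewrite dk.
  have ty : t y = y by exact: (t_id k).
  have yd : y = d j by apply: t_inj.
  have len0 : 0 <= (0 : R) < d j.+1 - d j.
    by have := d_lt j; rewrite leq_ord => /(_ isT); lra.
  have [||ejk] := @cell_uniq _ _ _ d_lt j (Ordinal kn) 0 (y - d k) len0; rewrite /=.
  - by lra.
  - by lra.
  - by lra.
have prI : injective pr.
  move=> j j' e; have /(t_inj _ _ (dI j) (dI j')) ed : t (d j) = t (d j').
    by rewrite !Hpr e.
  have len0 (i : 'I_n.+1) : 0 <= (0 : R) < d i.+1 - d i.
    by have := d_lt i; rewrite leq_ord => /(_ isT); lra.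
  have [|->] // := @cell_uniq _ _ _ d_lt j j' 0 0 (len0 j) (len0 j').
  by rewrite !addr0.
apply: (@circle_system_cells _ n t d d0 dn d_lt t_id (finv pr)).
- exact: finv_inj prI.
- by move=> i; rewrite Hpr (f_finv prI).
Qed.

(** * Rotations and rescalings *)

Lemma modr_range (R : realType) (t p : R) : 0 < p -> 0 <= modr t p < p.
Proof.
move=> p0; have := Num.Theory.floor_itv (t / p).
rewrite /modr ler_pdivlMr // ltr_pdivrMr // intrD mulrDl mul1r; lra.
Qed.

Lemma modr_eq (R : realType) (t p q : R) (m : int) :
  0 <= q < p -> t = q + m%:~R * p -> modr t p = q.
Proof.
move=> Hq ->; have p0 : 0 < p by lra.
rewrite /modr; have -> : Num.floor ((q + m%:~R * p) / p) = m.
  apply: Num.Theory.floor_def.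
  by rewrite ler_pdivlMr // ltr_pdivrMr // intrD mulrDl mul1r; lra.
by lra.
Qed.

Lemma modr_decomp (R : realType) (t p : R) :
  t = modr t p + (Num.floor (t / p))%:~R * p.
Proof. by rewrite /modr subrK. Qed.

Lemma modrZ (R : realType) (c t p : R) : 0 < c -> 0 < p ->
  modr (c * t) (c * p) = c * modr t p.
Proof.
move=> c0 p0; have /andP[m0 mp] := modr_range t p0.
apply: (modr_eq (m := Num.floor (t / p))).
  by rewrite pmulr_rge0 // m0 ltr_pM2l.
by rewrite {1}(modr_decomp t p); ring.
Qed.

Lemma rotations_piecewise (R : realType) (N : nat) (a b : 'I_N -> R) (g : R -> R) :
  (0 < N)%N ->
  (forall (i : 'I_N) x, i%:R / N%:R <= x < i.+1%:R / N%:R ->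
    g x = b i + modr (x - i%:R / N%:R + a i) N%:R^-1) ->
  piecewise01 (fun c d : R => exists t, forall x, c <= x < d -> g x = x + t).
Proof.
move=> N0 Hg; have NR0 : 0 < N%:R^-1 :> R by rewrite invr_gt0 ltr0n.
(* Besides the ends [i / N], the map breaks where the rotation by [a i] wraps around. *)
pose F := [seq (i%:R / N%:R : R) | i : 'I_N] ++
  [seq i%:R / N%:R + modr (- a i) N%:R^-1 | i : 'I_N].
have [n [d [d0 dn d_lt dF]]] := sorted_cuts F.
have nF p k : (k <= n)%N -> p \in F -> ~~ (d k < p < d k.+1).
  move=> kn pF; apply/negP => /andP[dkp pdk].
  have [d0k dk1] := d_range d0 dn d_lt (Ordinal (kn : (k < n.+1)%N)).
  have [|j jn ep] := dF p pF; first by move: d0k dk1 => /=; lra.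
  case: (leqP j k) => jk.
    by have := @d_mono _ _ _ d_lt j k; rewrite jk leqW // => /(_ isT); lra.
  by have := @d_mono _ _ _ d_lt k.+1 j; rewrite jk leqW // => /(_ isT); lra.
apply: (piecewise01_intro (n := n.+1) (S := d)) => // k kn.
have [/= dk0 dk1] := d_range d0 dn d_lt (Ordinal kn).
have dkk := d_lt k kn.
have [||i iN /andP[idk dki]] := @locate _ (fun i => i%:R / N%:R) N (d k).
- by rewrite mul0r.
- by rewrite divff ?pnatr_eq0 -?lt0n //; lra.
pose i' := Ordinal iN; pose q := modr (d k - i%:R / N%:R + a i') N%:R^-1.
have Hq : 0 <= q < N%:R^-1 by exact: modr_range.
have Sdiv : i.+1%:R / N%:R = i%:R / N%:R + N%:R^-1 :> R.
  by rewrite -addn1 natrD mulrDl mul1r.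
exists (b i' + q - d k) => x /andP[dkx xdk].
have xi : x < i.+1%:R / N%:R.
  rewrite ltNge; apply/negP => le.
  case: (leqP N i.+1) => iN1.
    have iN' : N = i.+1 by apply/eqP; rewrite eqn_leq iN1.
    by move: le; rewrite -iN' divff ?pnatr_eq0 -?lt0n //; lra.
  have /(nF _ k kn) : i.+1%:R / N%:R \in F.
    by rewrite mem_cat; apply/orP; left; apply/mapP; exists (Ordinal iN1); rewrite ?mem_enum.
  by rewrite dki (le_lt_trans le xdk).
rewrite (Hg i') /=; last by rewrite (le_trans idk).
rewrite (@modr_eq _ _ _ (q + (x - d k)) (Num.floor ((d k - i%:R / N%:R + a i') / N%:R^-1))).
- by lra.
- apply/andP; split; first by lra.
  rewrite ltNge; apply/negP => le.
  (* [p] is where the rotated coordinate, equal to [q] at [d k], reaches [1 / N]: a wrapping point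
     strictly inside a cell, which is excluded. *)
  pose p := d k + (N%:R^-1 - q).
  have /(nF _ k kn) : p \in F.
    rewrite mem_cat; apply/orP; right; apply/mapP; exists i'; rewrite ?mem_enum //.
    rewrite (@modr_eq _ _ _ (p - i%:R / N%:R)
      (- Num.floor ((d k - i%:R / N%:R + a i') / N%:R^-1) - 1)) /=.
    + by rewrite addrC subrK.
    + by rewrite /p; move: Sdiv; lra.
    + have := modr_decomp (d k - i%:R / N%:R + a i') N%:R^-1.
      rewrite -/q intrD intrN /p; set z := (Num.floor _)%:~R => e.
      by move: e; nra.
  by rewrite /p; lra.
- have := modr_decomp (d k - i%:R / N%:R + a i') N%:R^-1.
  by rewrite -/q; lra.
Qed.

(** * Piecewise affine rescaling of consecutive intervals *)

Definition psum (R : realType) (a : nat -> R) (k : nat) : R := \sum_(j < k) a j.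

(** For [a >= 0] this truncates [y] to [[0, a]]; written with absolute values, its continuity
    reduces to that of the norm. *)
Definition clamp (R : realType) (a y : R) : R := (a + `|y| - `|y - a|) / 2.

(* The increasing homeomorphism mapping the k-th of the consecutive intervals of
   lengths [a] affinely onto the k-th of those of lengths [b]. *)
Definition interpolate (R : realType) N (a b : nat -> R) (x : R) : R :=
  \sum_(k < N) b k / a k * clamp (a k) (x - psum a k).

Section Interpolate.
Variables (R : realType) (N : nat).
Implicit Types (a b : nat -> R).

Lemma psumS a k : psum a k.+1 = psum a k + a k.
Proof. by rewrite /psum big_ord_recr. Qed.

Lemma psum0 a : psum a 0 = 0.
Proof. by rewrite /psum big_ord0. Qed.

Lemma psum_mono a i j : (forall k, (k < N)%N -> 0 < a k) -> (i <= j <= N)%N ->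
  psum a i <= psum a j.
Proof.
move=> a0 /andP[ij jN]; rewrite -(subnKC ij).
have: (i + (j - i) <= N)%N by rewrite subnKC.
elim: (j - i)%N => [|k IH]; rewrite ?addn0 // addnS => H.
by apply: le_trans (IH (ltnW H)) _; rewrite psumS lerDl ltW // a0.
Qed.

Lemma psum_locate a x : 0 <= x < psum a N ->
  exists k r, [/\ (k < N)%N, 0 <= r < a k & x = psum a k + r].
Proof.
move=> /andP[x0 xN]; have [||k kN /andP[k1 k2]] := @locate _ (psum a) N x; rewrite ?psum0 //.
by exists k, (x - psum a k); split=> //; [move: k2; rewrite psumS; lra | lra].
Qed.

Lemma psum_uniq a k k' r r' : (forall k, (k < N)%N -> 0 < a k) -> (k < N)%N -> (k' < N)%N ->
  0 <= r < a k -> 0 <= r' < a k' -> psum a k + r = psum a k' + r' -> k = k' /\ r = r'.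
Proof.
move=> a0; wlog le : k k' r r' / (k <= k')%N.
  move=> W kN k'N H H' e; case: (leqP k k') => [le|/ltnW le]; first exact: W e.
  by have [-> ->] := W _ _ _ _ le k'N kN H' H (esym e).
move=> kN k'N Hr Hr' e; move: le; rewrite leq_eqVlt => /predU1P [kk|lt].
  by move: e; rewrite kk => /addrI ->.
have : psum a k.+1 <= psum a k' by apply: psum_mono; rewrite // lt ltnW.
by rewrite psumS; lra.
Qed.

Lemma psum_range a k r : (forall k, (k < N)%N -> 0 < a k) -> psum a N = 1 ->
  (k < N)%N -> 0 <= r < a k -> I01 R (psum a k + r).
Proof.
move=> a0 aN kN Hr; apply/I01P.
have : psum a 0 <= psum a k by apply: psum_mono; rewrite // leq0n ltnW.
have : psum a k.+1 <= psum a N by apply: psum_mono; rewrite // kN leqnn.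
by rewrite psum0 aN psumS; lra.
Qed.

Lemma clamp_le0 (a y : R) : 0 <= a -> y <= 0 -> clamp a y = 0.
Proof. by move=> a0 y0; rewrite /clamp !ler0_norm //; lra. Qed.

Lemma clamp_id (a y : R) : 0 <= y <= a -> clamp a y = y.
Proof. by move=> /andP[y0 ya]; rewrite /clamp ger0_norm // ler0_norm //; lra. Qed.

Lemma clamp_ge (a y : R) : 0 <= a <= y -> clamp a y = a.
Proof. by move=> /andP[y0 ya]; rewrite /clamp !ger0_norm //; lra. Qed.

(** Intervals before the k-th are saturated and contribute their full target length; those after it
    contribute 0. *)
Lemma interpolateE a b k r : (forall k, (k < N)%N -> 0 < a k) -> (k < N)%N ->
  0 <= r < a k -> interpolate N a b (psum a k + r) = psum b k + b k / a k * r.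
Proof.
move=> a0 kN Hr; rewrite /interpolate.
rewrite -(big_mkord xpredT (fun j => b j / a j * clamp (a j) (psum a k + r - psum a j))).
rewrite (big_cat_nat (n := k)) //=; last exact: ltnW.
rewrite (big_cat_nat (n := k.+1) (m := k)) //= big_nat1.
have -> : psum a k + r - psum a k = r by lra.
rewrite clamp_id; last by lra.
rewrite [X in _ + (_ + X)](_ : _ = 0) ?addr0; last first.
  rewrite big_nat; apply: big1 => j /andP[kj jN].
  have : psum a k.+1 <= psum a j by apply: psum_mono; rewrite // kj ltnW.
  rewrite psumS => le; rewrite clamp_le0 ?mulr0 //; first by rewrite ltW // a0.
  by lra.
congr (_ + _); rewrite big_mkord; apply: eq_bigr => -[j jk] _ /=.
have jN : (j < N)%N by exact: ltn_trans kN.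
have : psum a j.+1 <= psum a k by apply: psum_mono; rewrite // jk ltnW.
have := a0 _ jN; rewrite psumS => aj le; rewrite clamp_ge; last by lra.
by rewrite divfK // gt_eqF.
Qed.

Lemma interpolate_continuous a b : continuous (interpolate N a b).
Proof.
rewrite /interpolate; elim: N => [|M IH] x.
  under eq_fun do rewrite big_ord0.
  exact: cvg_cst.
under eq_fun do rewrite big_ord_recr /=.
apply: cvgD; first exact: IH.
apply: cvgM; first exact: cvg_cst.
apply: cvgM; last exact: cvg_cst.
have c1 : {for x, continuous (fun y : R => y - psum a M)}.
  by apply: cvgD; [exact: cvg_id | exact: cvg_cst].
apply: cvgB.
  apply: cvgD; first exact: cvg_cst.
  exact: cvg_norm.
apply: cvg_norm; apply: cvgB; first exact: c1.
exact: cvg_cst.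
Qed.

Lemma interpolate_stable a b : (forall k, (k < N)%N -> 0 < a k) ->
  (forall k, (k < N)%N -> 0 < b k) -> psum a N = 1 -> psum b N = 1 ->
  forall x, I01 R x -> I01 R (interpolate N a b x) /\
    interpolate N b a (interpolate N a b x) = x.
Proof.
move=> a0 b0 aN bN x /I01P; rewrite -aN => /psum_locate [k [r [kN Hr ->]]].
have [ak bk] := (a0 _ kN, b0 _ kN).
have Hr' : 0 <= b k / a k * r < b k.
  have /andP[r0 ra] := Hr; apply/andP; split.
    by rewrite !mulr_ge0 ?invr_ge0 // ltW.
  by rewrite mulrAC ltr_pdivrMr // ltr_pM2l.
rewrite interpolateE //; split; first exact: psum_range.
rewrite interpolateE //; congr (_ + _); field.
by rewrite !gt_eqF.
Qed.

Lemma interpolate_pl_homeo a b : (forall k, (k < N)%N -> 0 < a k) ->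
  (forall k, (k < N)%N -> 0 < b k) -> psum a N = 1 -> psum b N = 1 ->
  is_pl_homeo (interpolate N a b).
Proof.
move=> a0 b0 aN bN.
have ab := interpolate_stable a0 b0 aN bN.
have ba := interpolate_stable b0 a0 bN aN.
have bij : set_bij (I01 R) (I01 R) (interpolate N a b).
  split.
  - by move=> x /ab [].
  - move=> x y; rewrite !inE => Ix Iy e.
    by rewrite -(ab _ Ix).2 e (ab _ Iy).2.
  - by move=> y Iy; exists (interpolate N b a y); [exact: (ba _ Iy).1 | exact: (ba _ Iy).2].
split=> //.
- exact/continuous_subspaceT/interpolate_continuous.
(* The inverse is the same formula with the two lists of lengths exchanged. *)
- apply: (@subspace_eq_continuous _ _ _ (interpolate N b a)).
    move=> x; rewrite inE => Ix; apply/esym/(inv01_eq bij); first exact: (ba _ Ix).1.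
    exact: (ba _ Ix).2.
  exact/continuous_subspaceT/interpolate_continuous.
- apply: (piecewise01_intro (n := N) (S := psum a)); rewrite ?psum0 //.
  + by move=> i iN; rewrite psumS ltrDl a0.
  + move=> i iN; exists (b i / a i), (psum b i - b i / a i * psum a i) => x.
    rewrite psumS => Hx.
    have -> : x = psum a i + (x - psum a i) by lra.
    by rewrite interpolateE //; [ring | lra].
Qed.
End Interpolate.

(** * Conjugation into G_n *)

Section Conjugacy.
Variables (R : realType) (t : R -> R) (N : nat) (L : nat -> R) (gl : nat -> R -> R).
Hypothesis t_bij : set_bij (I01 R) (L01 R) t.
Hypothesis CS : circle_system t N L gl.

Lemma cs_stable k u : (k < N)%N -> 0 <= u -> I01 R (gl k u).
Proof. by move=> kN u0; have [] := cs_line CS kN u0. Qed.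

Lemma cs_N_gt0 : (0 < N)%N.
Proof.
have I0 : I01 R 0 by apply/I01P; lra.
by have [k [u [kN _ _]]] := cs_cover CS I0; exact: leq_trans kN.
Qed.

Lemma cs_natr_gt0 : 0 < N%:R^-1 :> R.
Proof. by rewrite invr_gt0 ltr0n cs_N_gt0. Qed.

Lemma cs_periodn k u m : (k < N)%N -> 0 <= u -> gl k (u + m%:R * L k) = gl k u.
Proof.
move=> kN u0; elim: m => [|m IH]; first by rewrite mul0r addr0.
have -> : u + m.+1%:R * L k = u + m%:R * L k + L k by rewrite -addn1 natrD; ring.
rewrite (cs_period CS) //; have := cs_pos CS kN => Lk.
by rewrite addr_ge0 // mulr_ge0 // ltW.
Qed.

Lemma cs_modr k u : (k < N)%N -> 0 <= u -> gl k (modr u (L k)) = gl k u.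
Proof.
move=> kN u0; have Lk := cs_pos CS kN.
have /andP[m0 _] := modr_range u Lk.
have f0 : (0 <= Num.floor (u / L k))%R by rewrite floor_ge0 divr_ge0 // ltW.
rewrite [in RHS](modr_decomp u (L k)).
case: (Num.floor _) f0 => // m _.
exact: (esym (cs_periodn m kN m0)).
Qed.

Lemma arrange_ex : exists E : R -> R, is_iet E /\
  forall k u, (k < N)%N -> 0 <= u < L k -> E (gl k u) = psum L k + u.
Proof.
have /choice [p Hp] : forall x, exists p : nat * R,
    I01 R x -> [/\ (p.1 < N)%N, 0 <= p.2 < L p.1 & gl p.1 p.2 = x].
  move=> x; have [Ix|nIx] := EM (I01 R x); last by exists (0%N, 0).
  by have [k [u H]] := cs_cover CS Ix; exists (k, u).
have L0 := cs_pos CS; have LN : psum L N = 1 by exact: cs_sum CS.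
pose E x := psum L (p x).1 + (p x).2.
have EE k u : (k < N)%N -> 0 <= u < L k -> E (gl k u) = psum L k + u.
  move=> kN Hu; have /andP[u0 _] := Hu.
  have [pN Hpu pgl] := Hp _ (cs_stable kN u0).
  by rewrite /E; have [-> ->] := cs_inj CS pN kN Hpu Hu pgl.
exists E; split=> //; split.
  split.
  - by move=> x /Hp [pN Hpu _]; exact: (psum_range L0 LN pN Hpu).
  - move=> x y; rewrite !inE => /Hp [kN Hu ex] /Hp [k'N Hu' ey].
    by move=> /(psum_uniq L0 kN k'N Hu Hu') [e e']; rewrite -ex -ey e e'.
  - move=> y /I01P; rewrite -LN => /psum_locate [k [r [kN Hr ->]]].
    exists (gl k r); last exact: EE.
    by apply: cs_stable => //; have /andP[] := Hr.
(* Each piece of [cs_cut] runs at unit speed along one circle without passing its origin, so [E]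
   translates it. *)
have [n [S [S0 Sn Slt H]]] := piecewise01_elim (cs_cut CS).
apply: (piecewise01_intro S0 Sn Slt) => i /H [k [u [kN u0 uL Hgl]]].
exists (psum L k + u - S i) => x Hx.
have xE : gl k (u + (x - S i)) = x by rewrite Hgl; lra.
by rewrite -{1}xE EE //; lra.
Qed.

Section Rotation.
Variables (f : R -> R) (F : seq R).
Hypothesis f_bij : set_bij (I01 R) (I01 R) f.
Hypothesis f_cuts : cuts F f.
Hypothesis f_glue : forall x, I01 R x -> lgerm f (t x) (t (f x)).

(* [f] maps flow lines to flow lines, and these are determined by their origin. *)
Lemma map_circle k : (k < N)%N -> exists j a, [/\ (j < N)%N, 0 <= a < L j,
  L j = L k & forall u, 0 <= u -> f (gl k u) = gl j (u + a)].
Proof.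
move=> kN; have fI := set_bij01_stable f_bij.
have [j [a [jN Ha e0]]] := cs_cover CS (fI _ (cs_stable kN (lexx 0))).
have /andP[a0 aL] := Ha.
have [Lk Lj] := (cs_pos CS kN, cs_pos CS jN).
have fgl u : 0 <= u -> f (gl k u) = gl j (u + a).
  move=> u0; apply: (flow_line_uniq t_bij (b := f \o gl k) (c := fun u => gl j (u + a))) => //.
  - exact: flow_line_map f_cuts fI f_glue (cs_line CS kN).
  - exact: flow_line_shift a0 (cs_line CS jN).
  - by rewrite /= add0r.
exists j, a; split=> //; apply/eqP; rewrite eq_le; apply/andP; split.
(* The period of circle [k] brings the image line back to its start, so [L k] is a positive multiple
   of [L j]. *)
- have Lk0 : 0 <= L k by exact: ltW.
  have : gl j (modr (L k + a) (L j)) = gl j a.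
    rewrite cs_modr // ?addr_ge0 // -fgl // e0 -[L k in LHS]add0r.
    by rewrite (cs_period CS).
  move=> /(cs_inj CS jN jN (modr_range _ Lj) Ha) [_ /esym].
  have := modr_decomp (L k + a) (L j); set z := Num.floor _ => e em.
  have zL : L k = z%:~R * L j by move: e; rewrite -em; lra.
  have z0 : 0 < z by rewrite -(ltr0z R) -(pmulr_lgt0 _ Lj) -zL.
  by rewrite zL ler_pMl // ler1z; lia.
(* If [L j] were smaller, the points of circle [k] at times 0 and [L j] would be distinct with the
   same image. *)
- rewrite leNgt; apply/negP => lt.
  have : f (gl k (L j)) = f (gl k 0).
    by rewrite (fgl _ (lexx 0)) (fgl _ (ltW Lj)) add0r addrC (cs_period CS).
  move=> /(set_bij01_inj f_bij (cs_stable kN (ltW Lj)) (cs_stable kN (lexx 0))).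
  by case/(cs_inj CS kN kN); lra.
Qed.

Variable g : R -> R.
Hypothesis g_bij : set_bij (I01 R) (I01 R) g.
Hypothesis gE : forall k u, (k < N)%N -> 0 <= u < L k ->
  g (gl k u) = k%:R / N%:R + (N%:R * L k)^-1 * u.

Lemma conj_in_Gn : in_Gn N (conj01 g f).
Proof.
have N0 := cs_N_gt0; have NR0 : 0 < N%:R :> R by rewrite ltr0n.
have /choice [ja Hja] : forall i : 'I_N, exists ja : 'I_N * R,
    [/\ 0 <= ja.2 < L ja.1, L ja.1 = L i &
      forall u, 0 <= u -> f (gl i u) = gl ja.1 (u + ja.2)].
  move=> i; have [j [a [jN Ha eL H]]] := map_circle (ltn_ord i).
  by exists (Ordinal jN, a).
pose s i := (ja i).1; pose a i := (ja i).2.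
(* If circles [i] and [i'] had the same target, the point at time [a i' - a i] on the first and the
   origin of the second would have the same image. *)
have sI : injective s.
  move=> i i'; wlog le : i i' / a i <= a i'.
    move=> W e; case: (leP (a i) (a i')) => [le|/ltW le]; first exact: W.
    by apply/esym/W.
  move=> e; have [/andP[a0 aL] eL H] := Hja i; have [/andP[a'0 a'L] eL' H'] := Hja i'.
  rewrite -/(a i) -/(a i') -/(s i) -/(s i') in a0 aL a'0 a'L eL eL' H H'.
  have d0 : 0 <= a i' - a i by lra.
  have := H _ d0; rewrite subrK e -[a i' in RHS]add0r -H' //.
  move=> /(set_bij01_inj f_bij (cs_stable (ltn_ord i) d0) (cs_stable (ltn_ord i') (lexx 0))).
  case/(cs_inj CS (ltn_ord i) (ltn_ord i')) => [||ii _].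
  - by rewrite e in eL aL; lra.
  - by rewrite lexx (cs_pos CS).
  - exact: val_inj.
have main (i : 'I_N) x : i%:R / N%:R <= x < i.+1%:R / N%:R ->
    conj01 g f x = (perm sI i)%:R / N%:R +
      modr (x - i%:R / N%:R + (N%:R * L i)^-1 * a i) N%:R^-1.
  move=> Hx; rewrite permE; have [/andP[a0 aL] eL H] := Hja i.
  rewrite -/(a i) -/(s i) in a0 aL eL H *.
  have Li := cs_pos CS (ltn_ord i); have Lj := cs_pos CS (ltn_ord (s i)).
  (* [w] is the time coordinate on circle [i] of the preimage of [x], as [g] has slope
     [1 / (N * L i)] there. *)
  pose w := (x - i%:R / N%:R) * (N%:R * L i).
  have Hw : 0 <= w < L i.
    have /andP[x0 x1] := Hx; apply/andP; split.
      by apply: mulr_ge0; [rewrite subr_ge0 | rewrite mulr_ge0 // ltW].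
    have lt : x - i%:R / N%:R < N%:R^-1.
      by move: x1; rewrite -addn1 natrD mulrDl mul1r; lra.
    have : w < N%:R^-1 * (N%:R * L i) by rewrite ltr_pM2r // mulr_gt0.
    by rewrite mulKf // gt_eqF.
  have /andP[w0 _] := Hw.
  have xE : x = i%:R / N%:R + (N%:R * L i)^-1 * w.
    by rewrite /w [_^-1 * _]mulrC mulfK ?gt_eqF ?mulr_gt0 // addrC subrK.
  have gx : inv01 g x = gl i w.
    by apply: (inv01_eq g_bij); rewrite ?gE -?xE //; exact: cs_stable.
  have wa0 : 0 <= w + a i by exact: addr_ge0.
  rewrite /conj01 /= gx H // -(cs_modr (ltn_ord (s i)) wa0).
  rewrite gE //; last exact: modr_range.
  (* Source and target circles have equal lengths, hence equal slopes, and a rotation modulo [L i]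
     rescales to one modulo [1 / N]. *)
  rewrite eL; congr (_ + _); rewrite -modrZ // ?invr_gt0 ?mulr_gt0 //.
  have -> : (N%:R * L i)^-1 * L i = N%:R^-1.
    by field; rewrite !gt_eqF.
  by congr (modr _ _); rewrite {1}xE; ring.
split; last by exists (perm sI), (fun i : 'I_N => (N%:R * L i)^-1 * a i).
split; first exact: conj01_bij.
exact: rotations_piecewise N0 main.
Qed.
End Rotation.
End Conjugacy.

Theorem theorem3 (R : realType) (f h : R -> R)
    (f_iet : is_iet f) (h_iet : is_iet h)
    (fh_action : bs_action f h)
    (fh_faithful : bs_faithful f h)
    (fh_free : bs_free f h) :
  exists (n : nat) (E P : R -> R),
    let g := P \o E in
    [/\ (1 <= n)%N, is_iet E & is_pl_homeo P] /\
    [/\ in_Gn n (conj01 g f), in_Gn n (conj01 g h),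
        bs_action (conj01 g f) (conj01 g h) &
        bs_free (conj01 g f) (conj01 g h)].
Proof.
have [f_bij h_bij] := (f_iet.1, h_iet.1).
have [t [F [t_bij tF tf th]]] := gluing_ex f_iet h_iet fh_action fh_free.
have [N [L [gl CS]]] := circle_system_ex t_bij tF.
have [E [E_iet EE]] := arrange_ex CS.
have N0 := cs_N_gt0 CS; have NR0 := cs_natr_gt0 CS.
have unif k : psum (fun=> N%:R^-1) k = k%:R / N%:R :> R.
  by rewrite /psum sumr_const card_ord mulrC mulr_natr.
have P_pl : is_pl_homeo (interpolate N L (fun=> N%:R^-1)).
  apply: interpolate_pl_homeo => //; first exact: cs_pos CS.
    exact: cs_sum CS.
  by rewrite unif divff // pnatr_eq0 -lt0n.
set P := interpolate _ _ _ in P_pl.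
have g_bij : set_bij (I01 R) (I01 R) (P \o E).
  by case: P_pl => P_bij _ _ _; exact: set_bij_comp E_iet.1 P_bij.
have gE k u : (k < N)%N -> 0 <= u < L k ->
    (P \o E) (gl k u) = k%:R / N%:R + (N%:R * L k)^-1 * u.
  move=> kN Hu; rewrite /= EE // /P interpolateE //; last exact: cs_pos CS.
  by rewrite unif invfM.
have [Ff cf] := iet_cuts f_iet; have [Fh ch] := iet_cuts h_iet.
exists N, E, P => g; split=> //; split.
- exact: (conj_in_Gn t_bij CS f_bij cf tf g_bij gE).
- exact: (conj_in_Gn t_bij CS h_bij ch th g_bij gE).
- exact: bs_action_conj.
- exact: bs_free_conj.
Qed.
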